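(* Let $n\ge 2$. Assume that $2\le k\le n+2$ if $n\ge 3$, and that $k\in\{2,3\}$ if $n=2$. Let $g\in \mathrm{SL}_{2n}(\mathbb{R})$ and let $\langle\cdot,\cdot\rangle^g$ be the symplectic form on $\mathbb{R}^{2n}$ associated with $g$. Then the set $$\left\{\left(\langle \mathbf v_i,\mathbf v_j\rangle^g\right)_{1\le i<j\le k}:\ \mathbf v_1,\ldots,\mathbf v_k\in\mathbb{Z}^{2n}\right\}$$ is dense in $\mathbb{R}^{\frac12 k(k-1)}$ if and only if $\langle\cdot,\cdot\rangle^g$ is not a scalar multiple of any symplectic form with integer coefficients.
   Context: The standard symplectic form on $\mathbb{R}^{2n}$ is $\langle \mathbf v_1,\mathbf v_2\rangle=\mathbf v_1^T J_n\mathbf v_2$ with $J_n=\begin{pmatrix}0&I_n\\-I_n&0\end{pmatrix}$. For $g\in\mathrm{SL}_{2n}(\mathbb{R})$, $\langle \mathbf v_1,\mathbf v_2\rangle^g=\langle g\mathbf v_1,g\mathbf v_2\rangle$ for all $\mathbf v_1,\mathbf v_2\in\mathbb{R}^{2n}$. A symplectic form means a non-degenerate skew-symmetric bilinear form; scalar multiples are by real numbers; a form has integer coefficients if its matrix in the standard basis has integer entries. *)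

(* Defs.v *)
From HB Require Import structures.
From mathcomp Require Import all_boot all_order all_algebra.
From mathcomp Require Import all_classical all_reals all_analysis.

Set Implicit Arguments.
Unset Strict Implicit.
Unset Printing Implicit Defensive.

Import Order.TTheory GRing.Theory Num.Theory.
Import numFieldNormedType.Exports.

Local Open Scope classical_set_scope.
Local Open Scope ring_scope.

(* R^{2n} is 'cV[R]_(n + n), so that J_n is literally a 2 x 2 block matrix. *)
Definition symp_mx (R : realType) (n : nat) : 'M[R]_(n + n) :=
  block_mx 0 1%:M (- 1%:M) 0.

Definition std_symp (R : realType) (n : nat) (u v : 'cV[R]_(n + n)) : R :=
  (u^T *m symp_mx R n *m v) 0 0.

Definition symp_of (R : realType) (n : nat) (g : 'M[R]_(n + n))
    (u v : 'cV[R]_(n + n)) : R :=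
  std_symp (g *m u) (g *m v).

Definition integral_form (R : realType) (m : nat)
    (w : 'cV[R]_m -> 'cV[R]_m -> R) : Prop :=
  forall i j : 'I_m, w (delta_mx i 0) (delta_mx j 0) \is a Num.int.

(* [is_psymplectic w] on a bilinear [w : {skew_symmetric _}] amounts to
   non-degeneracy: its remaining clauses (skewness, and w u u = 0 in
   characteristic 2) hold automatically here. *)
Definition multiple_of_integral_symp (R : realType) (m : nat)
    (b : 'cV[R]_m -> 'cV[R]_m -> R) : Prop :=
  exists (c : R) (w : {skew_symmetric 'cV[R]_m}),
    [/\ is_psymplectic w, integral_form w & forall u v, b u v = c * w u v].

Definition lt_pairs (k : nat) : seq ('I_k * 'I_k) :=
  [seq p : 'I_k * 'I_k <- enum {: 'I_k * 'I_k} | (p.1 < p.2)%N].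

Lemma size_lt_pairs (k : nat) : size (lt_pairs k) == (k * k.-1)./2.
Proof.
rewrite /lt_pairs size_filter -sum1_count -bin2 -bin2_sum.
rewrite (eq_bigl (fun p : 'I_k * 'I_k => true && (p.1 < p.2)%N)) //.
rewrite big_enum_cond /=.
rewrite -(pair_big_dep xpredT (fun i j : 'I_k => (i < j)%N) (fun _ _ => 1%N)) /=.
rewrite (exchange_big_dep xpredT) //= big_mkord; apply/eqP/eq_bigr => j _.
by rewrite -(big_ord_widen k (fun=> 1%N)) ?sum1_card ?card_ord // ltnW.
Qed.

(* The pairs i < j in lexicographic order, identifying families indexed by them
   with row vectors of length k(k-1)/2. *)
Definition lt_pairs_tuple (k : nat) : ((k * k.-1)./2).-tuple ('I_k * 'I_k) :=
  Tuple (size_lt_pairs k).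

Definition pair_values (R : realType) (T : Type) (k : nat) (b : T -> T -> R)
    (v : 'I_k -> T) : 'rV[R]_((k * k.-1)./2) :=
  \row_a let p := tnth (lt_pairs_tuple k) a in b (v p.1) (v p.2).

Definition int_vec (R : realType) (m : nat) (x : 'cV[int]_m) : 'cV[R]_m :=
  map_mx intr x.

Definition integral_values (R : realType) (m k : nat)
    (b : 'cV[R]_m -> 'cV[R]_m -> R) : set 'rV[R]_((k * k.-1)./2) :=
  [set pair_values b (fun i => int_vec R (x i)) | x in [set: 'I_k -> 'cV[int]_m]].

Arguments integral_values {R m} k b _.

(* Main.v *)
(** The argument is elementary (no unipotent dynamics).  Let [T0] be the Gram matrix of the
form.  If [T] is a limit of matrices [A^T T0 A] with [A] integral, [v] is an integer vector
and [f = v^T T], then [T + f /\ l] is such a limit whenever [l] is a limit of the line [R f]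
modulo the integer vectors: apply the integral transvections [1 + v l'] with [l'] close to
[s f - l] for a real [s].

Write [T = sum_i a_i M_i] with integer matrices [M_i] and rationally independent reals [a_i].
By Kronecker's theorem one may take [l = t v^T M_i] with [t] real, and a generic [t] enlarges
the rational span of the [M_i] unless this span contains every [(v^T M_i) /\ (v^T M_j)].  A
rational space of skew matrices which is closed in this sense, contains an invertible matrix
and has dimension at least 2 contains all skew matrices; dimension 1 would mean that the form
is a multiple of an integral one.  So some limit [T] has in each row rationally independent
off-diagonal entries.  By Kronecker again, the closure of the set of such [T] is stable under
all real elementary congruences, which carry the standard frame close to any [k < 2n] columns,
and every skew [k x k] matrix with [k <= 2n + 1] is the Gram matrix of [k] real vectors. *)

From HB Require Import structures.
Require Import Defs.
From mathcomp Require Import all_boot all_order all_algebra.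
From mathcomp Require Import all_classical all_reals all_analysis.
From mathcomp Require Import ring lra zify.

Set Implicit Arguments.
Unset Strict Implicit.
Unset Printing Implicit Defensive.

Import Order.TTheory GRing.Theory Num.Theory.
Import numFieldNormedType.Exports.

Local Open Scope classical_set_scope.
Local Open Scope ring_scope.

(** * Kronecker approximation *)

(** Independence over the rationals of [al] alone, without 1: Kronecker's theorem is used below with
    real multiples of [al], not integer ones. *)
Definition rat_free (R : realType) (I : finType) (al : I -> R) :=
  forall c : I -> rat, \sum_i ratr (c i) * al i = 0 -> forall i, c i = 0.

(** Pigeonhole: among [N ^ d + 1] multiples of [b] modulo 1, two fall into the same cube of side
    [1 / N]; their difference is the wanted multiple. *)
Lemma dirichlet (R : realType) d (b : 'I_d -> R) (e : R) : 0 < e ->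
  exists (q : nat) (p : 'I_d -> int),
    (0 < q)%N /\ forall i, `|q%:R * b i - (p i)%:~R| < e.
Proof.
move=> e0.
pose N := (Num.truncn e^-1).+1.
have N0 : (0 : R) < N%:R by rewrite ltr0n.
have Ne : 1 < N%:R * e by rewrite -ltr_pdivrMr // mul1r truncnS_gt.
(* Modulo [N], [w t i] tells which interval of length [1 / N] contains the fractional part of
   [t * b i]. *)
pose w (t : nat) (i : 'I_d) : int := Num.floor (N%:R * (t%:R * b i)).
pose F (t : 'I_(N ^ d).+1) : {ffun 'I_d -> 'I_N} :=
  [ffun i => inord `|(w t i %% N%:Z)%Z|%N].
have /injectivePn [t1 [t2 ne]] : ~~ injectiveb F.
  by apply/injectiveP => /leq_card; rewrite card_ffun !card_ord ltnn.
wlog lt12 : t1 t2 ne / (t1 < t2)%N.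
  move=> H eqF; have [lt|lt|eq] := ltngtP t1 t2; first exact: (H t1 t2).
    by apply: (H t2 t1) => //; rewrite eq_sym.
  by move: ne; rewrite (val_inj eq) eqxx.
move=> eqF.
have modE i : (w t1 i %% N%:Z)%Z = (w t2 i %% N%:Z)%Z.
  have := congr1 (fun f : {ffun 'I_d -> 'I_N} => val (f i)) eqF.
  have lm t : (0 <= (w t i %% N%:Z)%Z < N%:Z) by rewrite modz_ge0 ?ltz_pmod.
  by rewrite /F !ffunE /= !inordK; have := lm t1; have := lm t2; lia.
exists (t2 - t1)%N, (fun i => (w t2 i %/ N%:Z)%Z - (w t1 i %/ N%:Z)%Z).
split=> [|i]; first by rewrite subn_gt0.
have E : w t2 i - w t1 i =
    ((w t2 i %/ N%:Z)%Z - (w t1 i %/ N%:Z)%Z) * N%:Z.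
  have h1 := divz_eq (w t1 i) N%:Z; have h2 := divz_eq (w t2 i) N%:Z.
  by rewrite mulrBl {1}h2 {1}h1 modE opprD addrACA subrr addr0.
set p := (_ %/ _)%Z - _ in E *.
have {}E : (w t2 i)%:~R - (w t1 i)%:~R = p%:~R * N%:R :> R.
  by rewrite -intrB E intrM -pmulrn.
have /andP[a1 a2] := floor_itv (N%:R * (t1%:R * b i)).
have /andP[b1 b2] := floor_itv (N%:R * (t2%:R * b i)).
rewrite -/(w t1 i) intrD in a1 a2; rewrite -/(w t2 i) intrD in b1 b2.
rewrite natrB ?(ltnW lt12) //.
rewrite -(ltr_pM2l N0) -[N%:R in ltLHS]gtr0_norm // -normrM.
apply: lt_trans Ne; rewrite ltr_norml.
have -> : N%:R * ((t2%:R - t1%:R) * b i - p%:~R) =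
  N%:R * (t2%:R * b i) - (w t2 i)%:~R - (N%:R * (t1%:R * b i) - (w t1 i)%:~R).
  have -> : (w t2 i)%:~R = p%:~R * N%:R + (w t1 i)%:~R :> R by rewrite -E; ring.
  by ring.
lra.
Qed.

Lemma rat_free_neq0 (R : realType) (I : finType) (al : I -> R) i :
  rat_free al -> al i != 0.
Proof.
move=> H; apply/eqP => al0.
have Hs : \sum_j ratr ((j == i)%:R : rat) * al j = 0.
  rewrite (bigD1 i) //= al0 mulr0 add0r big1 // => j /negbTE ->.
  by rewrite rmorph0 mul0r.
by have /eqP := H _ Hs i; rewrite eqxx oner_eq0.
Qed.

(* Normalising [s al_0 - th_0] to be an integer turns the flow in dimension [d + 1] into the
   integer multiples of [b_i = al_i / al_0] in dimension [d].  Dirichlet gives [q] with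
   [de = q b] mod 1 small, so the multiples [n de] follow the flow [s de] closely. *)
Lemma kronecker_ord (R : realType) d (al : 'I_d -> R) : rat_free al ->
  forall (th : 'I_d -> R) (e : R), 0 < e ->
  exists (s : R) (l : 'I_d -> int), forall i, `|s * al i - th i - (l i)%:~R| < e.
Proof.
elim: d al => [|d IH] al Hal th e e0; first by exists 0, (fun=> 0); case.
have a0 : al ord0 != 0 by exact: rat_free_neq0.
pose b i := al (lift ord0 i) / al ord0.
have [|q [p [q0 qp]]] := dirichlet b (_ : 0 < e / 2); first lra.
pose de i := q%:R * b i - (p i)%:~R.
have Hde : rat_free de.
  move=> c Hc.
  (* Multiplying a relation between the [de i] by [al ord0] gives a relation between the [al i] with
     these coefficients. *)
  pose c' (i : 'I_d.+1) : rat :=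
    if unlift ord0 i is Some j then c j * q%:R else - \sum_j c j * (p j)%:~R.
  have Hc' : \sum_i ratr (c' i) * al i = 0.
    rewrite big_ord_recl /c' unlift_none rmorphN /= rmorph_sum /=.
    rewrite [X in _ + X](eq_bigr (fun i => ratr (c i * q%:R) * al (lift ord0 i)));
      last by move=> i _; rewrite liftK.
    transitivity (al ord0 * \sum_i ratr (c i) * de i); last by rewrite Hc mulr0.
    rewrite mulNr big_distrl big_distrr /= addrC -sumrB; apply: eq_bigr => i _.
    rewrite !rmorphM /= ratr_int ratr_nat /de /b; field; exact: a0.
  move=> i; have /eqP := Hal _ Hc' (lift ord0 i).
  by rewrite /c' liftK mulf_eq0 pnatr_eq0 gtn_eqF // orbF => /eqP.
have [|s [l Hl]] := IH de Hde (fun i => th (lift ord0 i) - th ord0 * b i) (e / 2).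
  lra.
pose fs := Num.floor s.
(* Coordinate 0 is hit exactly, by the integer [fs * q]; elsewhere, replacing [s] by its floor costs
   at most [|de j| < e / 2]. *)
exists ((th ord0 + fs%:~R * q%:R) / al ord0).
exists (fun i => if unlift ord0 i is Some j then l j + fs * p j else fs * q%:Z).
move=> i; case: (unliftP ord0 i) => [j|] ->; last first.
  by rewrite intrM -pmulrn divfK // addrAC addrK subrr normr0.
have -> : (th ord0 + fs%:~R * q%:R) / al ord0 * al (lift ord0 j) -
    th (lift ord0 j) - (l j + fs * p j)%:~R =
  (s * de j - (th (lift ord0 j) - th ord0 * b j) - (l j)%:~R) - (s - fs%:~R) * de j.
  by rewrite intrD intrM /de /b; field; exact: a0.
have dj := qp j; rewrite -/(de j) in dj.
apply: le_lt_trans (ler_normB _ _) _.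
have /andP[f1 f2] := floor_itv s; rewrite -/fs intrD in f1 f2.
have : `|(s - fs%:~R) * de j| <= `|de j|.
  by rewrite normrM ler_piMl ?normr_ge0 // ler_norml; lra.
have := Hl j; lra.
Qed.

Lemma kronecker (R : realType) (I : finType) (al : I -> R) : rat_free al ->
  forall (th : I -> R) (e : R), 0 < e ->
  exists (s : R) (l : I -> int), forall i, `|s * al i - th i - (l i)%:~R| < e.
Proof.
move=> Hal th e e0.
have Hal' : rat_free (fun j : 'I_#|I| => al (enum_val j)).
  move=> c Hc i; rewrite -(enum_valK i); apply: (Hal (fun j => c (enum_rank j))).
  rewrite -[RHS]Hc (reindex (@enum_val I I)) /=; last exact: onW_bij (enum_val_bij _).
  by apply: eq_bigr => j _; rewrite enum_valK.
have [s [l Hl]] := kronecker_ord Hal' (fun j => th (enum_val j)) e0.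
exists s, (fun i => l (enum_rank i)) => i.
by have := Hl (enum_rank i); rewrite /= enum_rankK.
Qed.

(** A nonempty open interval has positive Lebesgue measure, a countable set has measure zero. *)
Lemma avoid_countable (R : realType) (C : countType) (F : C -> R) (a b : R) :
  a < b -> exists2 x, a < x < b & forall c, F c != x.
Proof.
move=> ab; apply: contrapT => H.
have sub : `]a, b[%classic `<=` range F.
  move=> x /=; rewrite in_itv /= => abx; apply: contrapT => nx.
  by apply: H; exists x => // c; apply/eqP => Fc; apply: nx; exists c.
have cR : countable (range F).
  exact: sub_countable (card_image_le _ _) (countableP _).
have := countable_lebesgue_measure0 (sub_countable (subset_card_le sub) cR).
by rewrite lebesgue_measure_itv /= lte_fin ab -EFinB => -[]; lra.
Qed.

(** * Limits of integral congruences *)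

Definition skewmx (F : pzRingType) m (T : 'M[F]_m) := T^T = - T.

Definition wedge (F : comPzRingType) m (x y : 'rV[F]_m) : 'M[F]_m := x^T *m y - y^T *m x.

(** The Gram matrix of the columns of [A] for the bilinear form with matrix [T]. *)
Definition congr_mx (F : pzRingType) m p (A : 'M[F]_(m, p)) (T : 'M[F]_m) : 'M[F]_p :=
  A^T *m T *m A.

Definition close (R : realType) p q (e : R) (A B : 'M[R]_(p, q)) :=
  forall i j, `|A i j - B i j| < e.

Definition reach (R : realType) m (T0 T : 'M[R]_m) :=
  forall e, 0 < e -> exists A : 'M[int]_m, close e (congr_mx (map_mx intr A) T0) T.

Lemma close_refl (R : realType) p q (e : R) (A : 'M[R]_(p, q)) : 0 < e -> close e A A.
Proof. by move=> e0 i j; rewrite subrr normr0. Qed.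

Lemma close_trans (R : realType) p q (e1 e2 e : R) (A B C : 'M[R]_(p, q)) :
  e1 + e2 <= e -> close e1 A B -> close e2 B C -> close e A C.
Proof.
move=> he h1 h2 i j; apply: lt_le_trans he.
apply: le_lt_trans (ler_distD (B i j) _ _) _.
by apply: ltrD; [exact: h1 | exact: h2].
Qed.

Lemma congr_mxM (F : comPzRingType) m p q (A : 'M[F]_(m, p)) (B : 'M[F]_(p, q)) T :
  congr_mx B (congr_mx A T) = congr_mx (A *m B) T.
Proof. by rewrite /congr_mx trmx_mul !mulmxA. Qed.

Lemma congr_mx1 (F : pzRingType) m (T : 'M[F]_m) : congr_mx 1%:M T = T.
Proof. by rewrite /congr_mx trmx1 mul1mx mulmx1. Qed.

Lemma congr_skew (F : comPzRingType) m p (A : 'M[F]_(m, p)) (T : 'M[F]_m) :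
  skewmx T -> skewmx (congr_mx A T).
Proof.
move=> sT; rewrite /skewmx /congr_mx !trmx_mul trmxK sT mulNmx mulmxN mulmxA //.
Qed.

(** The entries of the two congruences differ by at most [d * a ^+ 2], since [a] bounds every
    absolute column sum of [A]. *)
Lemma close_congr (R : realType) m p (A : 'M[R]_(m, p)) (e : R) : 0 < e ->
  exists2 d, 0 < d & forall T T', close d T T' -> close e (congr_mx A T) (congr_mx A T').
Proof.
move=> e0; pose a := \sum_i \sum_k `|A k i|.
have a0 : 0 <= a by apply: sumr_ge0 => i _; apply: sumr_ge0.
have aa : 0 < a ^+ 2 + 1 by rewrite ltr_wpDl ?sqr_ge0.
exists (e / (a ^+ 2 + 1)); first by rewrite divr_gt0.
move=> T T' cT i j; set d := e / _ in cT.
have d0 : 0 < d by rewrite divr_gt0.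
have -> : congr_mx A T i j - congr_mx A T' i j =
    \sum_l \sum_k A k i * (T k l - T' k l) * A l j.
  rewrite /congr_mx !mxE -sumrB; apply: eq_bigr => l _.
  rewrite -mulrBl !mxE -sumrB mulr_suml; apply: eq_bigr => k _.
  by rewrite !mxE mulrBr mulrBl.
have col j' : \sum_k `|A k j'| <= a.
  by rewrite /a (bigD1 j') //= lerDl sumr_ge0 // => l _; rewrite sumr_ge0.
apply: (@le_lt_trans _ _ (d * a ^+ 2)); last first.
  by rewrite /d mulrAC ltr_pdivrMr // ltr_pM2l // ltrDl.
apply: le_trans (ler_norm_sum _ _ _) _.
apply: (@le_trans _ _ (\sum_l (d * a) * `|A l j|)).
  apply: ler_sum => l _; apply: le_trans (ler_norm_sum _ _ _) _.
  apply: (@le_trans _ _ (\sum_k d * `|A l j| * `|A k i|)).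
    apply: ler_sum => k _; rewrite !normrM (mulrC `|A k i|) mulrAC.
    by rewrite !ler_wpM2r // ltW // cT.
  by rewrite -mulr_sumr mulrAC ler_wpM2r // ler_wpM2l ?col // ltW.
by rewrite -mulr_sumr expr2 mulrA ler_wpM2l ?col // mulr_ge0 // ltW.
Qed.

Lemma reach_congr (R : realType) m (T : 'M[R]_m) (B : 'M[int]_m) :
  reach T (congr_mx (map_mx intr B) T).
Proof. by move=> e e0; exists B; apply: close_refl. Qed.

Lemma reach_refl (R : realType) m (T : 'M[R]_m) : reach T T.
Proof. by have := reach_congr T 1%:M; rewrite map_mx1 congr_mx1. Qed.

Lemma reach_trans (R : realType) m (T0 T1 T2 : 'M[R]_m) :
  reach T0 T1 -> reach T1 T2 -> reach T0 T2.
Proof.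
move=> h1 h2 e e0.
have [|B HB] := h2 (e / 2); first lra.
have [|d d0 Hd] := close_congr (map_mx intr B : 'M[R]_m) (_ : 0 < e / 2); first lra.
have [A HA] := h1 d d0; exists (A *m B).
rewrite map_mxM -congr_mxM; apply: close_trans (Hd _ _ HA) HB; lra.
Qed.

Lemma reach_closed (R : realType) m (T0 T : 'M[R]_m) :
  (forall e, 0 < e -> exists2 T1, reach T0 T1 & close e T1 T) -> reach T0 T.
Proof.
move=> H e e0; have [|T1 h1 c1] := H (e / 2); first lra.
have [|A HA] := h1 (e / 2); first lra.
by exists A; apply: close_trans HA c1; lra.
Qed.

Lemma skew_quad (R : numDomainType) m (T : 'M[R]_m) (v : 'cV[R]_m) :
  skewmx T -> v^T *m T *m v = 0.
Proof.
move=> sT; apply/matrixP => i j; rewrite !ord1 mxE.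
have E : (v^T *m T *m v)^T = - (v^T *m T *m v).
  by rewrite !trmx_mul trmxK sT mulNmx mulmxN mulmxA.
have /eqP := congr1 (fun M : 'M[R]_1 => M 0 0) E.
by rewrite !mxE -addr_eq0 -mulr2n mulrn_eq0 /= => /eqP.
Qed.

(** The term quadratic in [l] contains the scalar [v^T T v], which is zero by skewness. *)
Lemma congr_transvection (R : realType) m (T : 'M[R]_m) (v : 'cV[R]_m) (l : 'rV[R]_m) :
  skewmx T -> congr_mx (1%:M + v *m l) T = T - wedge (v^T *m T) l.
Proof.
move=> sT; have Tv : T *m v = - (v^T *m T)^T by rewrite trmx_mul trmxK sT mulNmx opprK.
have q0 := skew_quad v sT.
have -> : congr_mx (1%:M + v *m l) T = (1%:M + l^T *m v^T) *m T *m (1%:M + v *m l).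
  by rewrite /congr_mx [(_ + _)^T]raddfD /= trmx1 trmx_mul.
rewrite mulmxDl mul1mx mulmxDl !mulmxDr !mulmx1 mulmxA Tv mulNmx.
rewrite -!(mulmxA l^T) (mulmxA _ v l) q0 mul0mx mulmx0 addr0.
by rewrite /wedge opprB -addrA; congr (_ + _); rewrite addrC.
Qed.

Lemma unitmx_transvection (R : comUnitRingType) m (v : 'cV[R]_m) (l : 'rV[R]_m) :
  l *m v = 0 -> 1%:M + v *m l \in unitmx.
Proof.
move=> lv; have /mulmx1_unit[] // : (1%:M + v *m l) *m (1%:M - v *m l) = 1%:M.
rewrite mulmxDl mul1mx mulmxBr mulmx1.
have -> : v *m l *m (v *m l) = 0 by rewrite -!mulmxA (mulmxA l) lv mul0mx mulmx0.
by rewrite subr0 subrK.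
Qed.

(** With [l] close to [s f - sg], the transvection [1 + v l] changes [T] by [- f /\ l]. The part
    [s f] contributes nothing because [f /\ f = 0], which leaves [f /\ sg] up to a small error. *)
Lemma reach_shift (R : realType) m (T : 'M[R]_m) (v : 'cV[int]_m) (sg : 'rV[R]_m) :
  skewmx T ->
  (forall e, 0 < e -> exists (s : R) (l : 'rV[int]_m),
     close e (s *: ((map_mx intr v)^T *m T) - sg) (map_mx intr l)) ->
  reach T (T + wedge ((map_mx intr v)^T *m T) sg).
Proof.
move=> sT H e e0; set f := _ *m T in H *.
pose F := \sum_j `|f 0 j|.
have F0 : 0 <= F by apply: sumr_ge0.
have Fle j : `|f 0 j| <= F by rewrite /F (bigD1 j) //= lerDl sumr_ge0.
have [|s [l Hl]] := H (e / (2 * F + 1)); first by apply: divr_gt0; lra.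
exists (1%:M + v *m l).
rewrite map_mxD map_mx1 map_mxM congr_transvection // -/f.
clearbody f => i j; rewrite !mxE !big_ord1 !mxE.
have hi := Hl 0 i; have hj := Hl 0 j; rewrite !mxE in hi hj.
set d := e / _ in hi hj.
have -> : T i j - (f 0 i * (l 0 j)%:~R - (l 0 i)%:~R * f 0 j) -
    (T i j + (f 0 i * sg 0 j - sg 0 i * f 0 j)) =
  f 0 i * (s * f 0 j - sg 0 j - (l 0 j)%:~R) -
  (s * f 0 i - sg 0 i - (l 0 i)%:~R) * f 0 j by ring.
have de : d * (2 * F + 1) = e by rewrite divfK //; lra.
apply: le_lt_trans (ler_normB _ _) _; rewrite !normrM.
have h1 := ler_pM (normr_ge0 _) (normr_ge0 _) (Fle i) (ltW hj).
have h2 := ler_pM (normr_ge0 _) (normr_ge0 _) (ltW hi) (Fle j).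
have : 0 < d by apply: le_lt_trans hi.
by lra.
Qed.

(** * Spaces of skew matrices closed under wedge products *)

Definition dot (F : comPzRingType) m (x w : 'rV[F]_m) : F := \sum_i x 0 i * w 0 i.

Lemma dotE (F : comPzRingType) m (x w : 'rV[F]_m) : x *m w^T = (dot x w)%:M.
Proof.
apply/matrixP => i j; rewrite !ord1 !mxE; apply: eq_bigr => l _; by rewrite mxE.
Qed.

Lemma dotC (F : comPzRingType) m (x w : 'rV[F]_m) : dot x w = dot w x.
Proof. by apply: eq_bigr => i _; rewrite mulrC. Qed.

Lemma dotP (F : comPzRingType) m c (x y w : 'rV[F]_m) :
  dot (c *: x + y) w = c * dot x w + dot y w.
Proof.
rewrite /dot mulr_sumr -big_split /=; apply: eq_bigr => i _.
by rewrite !mxE mulrDl mulrA.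
Qed.

Lemma dotZ (F : comPzRingType) m c (x w : 'rV[F]_m) : dot (c *: x) w = c * dot x w.
Proof.
rewrite -[c *: x]addr0 dotP /dot [X in _ + X]big1 ?addr0 // => i _.
by rewrite mxE mul0r.
Qed.

Lemma dot_mx (F : comPzRingType) m (W : 'M[F]_m) (a b : 'rV[F]_m) :
  dot (a *m W) b = dot a (b *m W^T).
Proof.
have := mulmxA a W b^T; rewrite -[W *m b^T]trmxK trmx_mul trmxK !dotE.
by move=> /(congr1 (fun M : 'M[F]_1 => M 0 0)); rewrite !mxE eqxx !mulr1n.
Qed.

Lemma wedgeE (F : comPzRingType) m (x y : 'rV[F]_m) i j :
  wedge x y i j = x 0 i * y 0 j - y 0 i * x 0 j.
Proof. by rewrite !mxE !big_ord1 !mxE. Qed.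

Lemma wedgeC (F : comPzRingType) m (x y : 'rV[F]_m) : wedge x y = - wedge y x.
Proof. by rewrite /wedge opprB. Qed.

Lemma wedgeP (F : comPzRingType) m c (x y z : 'rV[F]_m) :
  wedge x (c *: y + z) = c *: wedge x y + wedge x z.
Proof.
apply/matrixP => i j.
by rewrite wedgeE [RHS]mxE [X in _ = X + _]mxE !wedgeE !mxE; ring.
Qed.

Lemma wedgexx (F : comPzRingType) m (x : 'rV[F]_m) : wedge x x = 0.
Proof. by rewrite /wedge subrr. Qed.

Lemma wedge0 (F : comPzRingType) m (x : 'rV[F]_m) : wedge x 0 = 0.
Proof. by rewrite /wedge trmx0 mul0mx mulmx0 subrr. Qed.

Lemma wedgeZ (F : comPzRingType) m c (x y : 'rV[F]_m) :
  wedge x (c *: y) = c *: wedge x y.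
Proof. by rewrite -[c *: y]addr0 wedgeP wedge0 addr0. Qed.

Lemma wedge_sum (F : comPzRingType) m (I : finType) (x : 'rV[F]_m) c (y : I -> 'rV_m) :
  wedge x (\sum_i c i *: y i) = \sum_i c i *: wedge x (y i).
Proof.
have wD u v : wedge x (u + v) = wedge x u + wedge x v.
  by rewrite -{1}[u]scale1r wedgeP scale1r.
by rewrite (big_morph _ wD (wedge0 x)); apply: eq_bigr => i _; rewrite wedgeZ.
Qed.

Lemma mulmx_wedge (F : comPzRingType) m (w x y : 'rV[F]_m) :
  w *m wedge x y = dot w x *: y - dot w y *: x.
Proof. by rewrite /wedge mulmxBr !mulmxA !dotE !mul_scalar_mx. Qed.

Lemma wedge_skew (F : comPzRingType) m (x y : 'rV[F]_m) : skewmx (wedge x y).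
Proof.
by rewrite /skewmx; apply/matrixP => i j; rewrite mxE wedgeE mxE wedgeE; ring.
Qed.

Lemma skew_sum (F : numFieldType) m (Z : 'M[F]_m) : skewmx Z ->
  2%:R *: Z = \sum_i \sum_j Z i j *: wedge (delta_mx 0 i) (delta_mx 0 j).
Proof.
move=> sZ; have Zn i j : Z j i = - Z i j.
  by have := congr1 (fun M : 'M[F]_m => M i j) sZ; rewrite !mxE.
have -> : \sum_i \sum_j Z i j *: wedge (delta_mx 0 i) (delta_mx 0 j) =
    \sum_i \sum_j Z i j *: delta_mx i j - \sum_i \sum_j Z i j *: delta_mx j i.
  rewrite -sumrB; apply: eq_bigr => i _; rewrite -sumrB; apply: eq_bigr => j _.
  by rewrite /wedge !trmx_delta !mul_delta_mx scalerBr.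
rewrite -matrix_sum_delta exchange_big /=.
under [X in _ - X]eq_bigr => i _ do under eq_bigr => j _ do rewrite Zn scaleNr.
under [X in _ - X]eq_bigr => i _ do rewrite sumrN.
by rewrite sumrN opprK -matrix_sum_delta scaler_nat.
Qed.

(** Every vector is an eigenvector of [N]: the basis vectors make [N] diagonal, and the all-ones
    vector makes its diagonal constant. *)
Lemma eigen_scalar (F : fieldType) m (N : 'M[F]_m) :
  (forall u : 'rV[F]_m, wedge u (u *m N) = 0) -> exists c, N = c%:M.
Proof.
move=> H.
have off i j : j != i -> N i j = 0.
  move=> ji; have := congr1 (fun M : 'M[F]_m => M i j) (H (delta_mx 0 i)).
  by rewrite -rowE wedgeE !mxE !eqxx (negbTE ji) /= mul1r mulr0 subr0.
case: m N H off => [|m] N H off; first by exists 0; apply/matrixP => -[].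
have dg i : N i i = N 0 0.
  have := congr1 (fun M : 'M[F]_m.+1 => M 0 i) (H (const_mx 1)).
  have E j : (const_mx 1 *m N) 0 j = N j j.
    rewrite mxE (bigD1 j) //= mxE mul1r big1 ?addr0 // => l lj.
    by rewrite off ?mulr0 // eq_sym.
  by rewrite wedgeE !E !mxE mul1r mulr1 => /eqP; rewrite subr_eq0 => /eqP.
exists (N 0 0); apply/matrixP => i j; rewrite mxE.
by have [->|ij] := eqVneq i j; [rewrite dg | rewrite off // eq_sym].
Qed.

Lemma rV_neq0 (F : pzRingType) m (x : 'rV[F]_m) : x != 0 -> exists i, x 0 i != 0.
Proof.
move=> x0; apply/existsP; apply: contra_neqT x0 => /existsPn h.
by apply/rowP => i; rewrite mxE; apply/eqP; have := h i; rewrite negbK.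
Qed.

Lemma two_nonzero (F : numFieldType) m (x y : 'rV[F]_m) : x != 0 -> y != 0 ->
  exists w, dot x w != 0 /\ dot y w != 0.
Proof.
have ex (z : 'rV[F]_m) : z != 0 -> exists w, dot z w != 0.
  move=> /rV_neq0[i zi].
  exists (delta_mx 0 i); rewrite /dot (bigD1 i) //= mxE !eqxx mulr1.
  by rewrite big1 ?addr0 // => j /negbTE ji; rewrite mxE eqxx ji mulr0.
move=> /ex[u xu] /ex[v yv].
have [yu|yu] := eqVneq (dot y u) 0; last by exists u.
have [xv|xv] := eqVneq (dot x v) 0; last by exists v.
exists (1 *: u + v); rewrite ![dot _ (_ + _)]dotC !dotP !mul1r !(dotC u) !(dotC v).
by rewrite yu xv addr0 add0r.
Qed.

(* Write [om] for the form [a W b^T] and call [y] good when [(w W) /\ y] is in [U] for all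
   [w] orthogonal to [y].  Closure applied to [W] and [x /\ y] makes [x] and [y] good as soon
   as [x /\ y] is a nonzero element of [U]; goodness spreads to a hyperplane, then to all
   vectors, so [U] contains every [(a W) /\ (b W)] with [om a b = 0].  These span a space of
   codimension one, and [W] itself lies outside it because [tr (W W^-1) = m <> 0]. *)
Lemma wedge_closed_full (F : numFieldType) m (U : {vspace 'M[F]_m}) (W S : 'M[F]_m) :
  (forall A B (v : 'rV_m), A \in U -> B \in U -> wedge (v *m A) (v *m B) \in U) ->
  W \in U -> S \in U -> W \in unitmx -> skewmx W -> (forall c, S <> c *: W) ->
  forall Z, skewmx Z -> Z \in U.
Proof.
move=> clU UW US uW sW nS.
pose om a b := dot (a *m W) b.
have omC a b : om a b = - om b a.
  by rewrite /om dot_mx sW mulmxN dotC -scaleN1r dotZ mulN1r.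
have omaa a : om a a = 0.
  by have /eqP := omC a a; rewrite -addr_eq0 -mulr2n mulrn_eq0 => /eqP.
have step x y w : wedge x y \in U ->
    wedge (w *m W) (dot w x *: y - dot w y *: x) \in U.
  by move=> xyU; rewrite -mulmx_wedge; apply: clU.
pose G y := forall w, dot y w = 0 -> wedge (w *m W) y \in U.
have wedgeG x y : wedge x y \in U -> wedge x y != 0 -> G y.
  move=> xyU xy0.
  have main w : dot y w = 0 -> dot x w != 0 -> wedge (w *m W) y \in U.
    move=> yw xw; have := step x y w xyU.
    rewrite !(dotC w) yw scale0r subr0 wedgeZ => /(memvZ (dot x w)^-1).
    by rewrite scalerA mulVf // scale1r.
  have [i [j xyij]] : exists i j, wedge x y i j != 0.
    apply: contrapT => h; move/eqP: xy0; apply; apply/matrixP => i j; rewrite [RHS]mxE.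
    by apply/eqP; apply: contrapT => hh; apply: h; exists i, j; apply/negP.
  (* [w0] is orthogonal to [y], and [dot x w0] is the nonzero entry of [x /\ y]. If [dot x w = 0],
     the claim for [w] is the difference of those for [w + w0] and [w0]. *)
  pose w0 : 'rV[F]_m := y 0 j *: delta_mx 0 i + (- y 0 i) *: delta_mx 0 j.
  have dd (z : 'rV[F]_m) l : dot (delta_mx 0 l) z = z 0 l.
    rewrite /dot (bigD1 l) //= mxE !eqxx mul1r big1 ?addr0 // => l' /negbTE h.
    by rewrite mxE h andbF mul0r.
  have yw0 : dot y w0 = 0 by rewrite dotC dotP dotZ !dd; ring.
  have xw0 : dot x w0 != 0.
    rewrite wedgeE in xyij; rewrite dotC dotP dotZ !dd.
    by rewrite (_ : _ + _ = x 0 i * y 0 j - y 0 i * x 0 j) //; ring.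
  move=> w yw; have [xw|xw] := eqVneq (dot x w) 0; last exact: main.
  have y1 : dot y (1 *: w + w0) = 0 by rewrite dotC dotP !(dotC _ y) yw yw0; ring.
  have x1 : dot x (1 *: w + w0) != 0 by rewrite dotC dotP !(dotC _ x) xw mulr0 add0r.
  have h1 := main _ y1 x1; have h0 := main _ yw0 xw0.
  have := memvB h1 h0; rewrite mulmxDl scale1r.
  by rewrite !(wedgeC _ y) -[w *m W]scale1r wedgeP scale1r opprD addrK scale1r.
(* Otherwise every vector is an eigenvector of [W^-1 S], so that [S] is a multiple of [W]. *)
have [v vne] : exists v, wedge (v *m W) (v *m S) != 0.
  apply: contrapT => h.
  have [|c Hc] := @eigen_scalar _ _ (invmx W *m S).
    move=> u; apply/eqP; apply: contrapT => hu; apply: h; exists (u *m invmx W).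
    by rewrite -!mulmxA mulVmx // mulmx1; apply/negP.
  by apply: (nS c); rewrite -[S](mulKVmx uW) Hc mul_mx_scalar.
set y1 := v *m S in vne.
have Gy1 : G y1 by apply: wedgeG vne; apply: clU.
have y10 : y1 != 0.
  by apply: contra_neq vne => ->; rewrite wedge0.
have GZ c y : G y -> G (c *: y).
  move=> Gy w; rewrite dotZ => /eqP; rewrite mulf_eq0 => /orP[/eqP->|/eqP yw].
    by rewrite scale0r wedge0 mem0v.
  by rewrite wedgeZ memvZ // Gy.
(* Goodness of [y1] puts [(b W) /\ y1] in [U]. If it is nonzero, [b W] is good by [wedgeG]; if it is
   zero, [b W] is a multiple of [y1]. *)
have Gperp b : dot y1 b = 0 -> G (b *m W).
  move=> y1b; have [w0|wn0] := eqVneq (wedge y1 (b *m W)) 0; last first.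
    by apply: wedgeG wn0; rewrite wedgeC memvN; exact: Gy1.
  have [i yi] := rV_neq0 y10.
  suff -> : b *m W = ((b *m W) 0 i / y1 0 i) *: y1 by exact: GZ.
  apply/rowP => j; rewrite [RHS]mxE.
  have := congr1 (fun M : 'M[F]_m => M i j) w0; rewrite wedgeE [RHS]mxE => /eqP.
  rewrite subr_eq0 => /eqP E; rewrite mulrAC -E mulrC mulrA mulVf ?mul1r //.
have Gall b : G (b *m W).
  move=> a; rewrite -/(om b a) => ba.
  have [bz|bn] := eqVneq (dot y1 b) 0; first exact: Gperp.
  have [az|an] := eqVneq (dot y1 a) 0.
    by rewrite wedgeC memvN; apply: Gperp => //; rewrite -/(om _ _) omC ba oppr0.
  (* Subtracting a multiple of [b] makes [a] orthogonal to [y1] and changes neither [om a b = 0] nor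
     [(a W) /\ (b W)]. *)
  pose a' := (- (dot y1 a / dot y1 b)) *: b + a.
  have a'y : dot y1 a' = 0 by rewrite dotC dotP !(dotC _ y1); field.
  have a'b : dot (a' *m W) b = 0.
    by rewrite -/(om _ _) omC /om dotC dotP !(dotC _ (b *m W)) -!/(om b _) omaa ba; ring.
  have := Gperp _ a'y b a'b.
  by rewrite mulmxDl -scalemxAl wedgeP wedgexx scaler0 add0r wedgeC memvN.
pose La a b := wedge (a *m W) (b *m W).
have La0 a b : om a b = 0 -> La a b \in U.
  by move=> ab; apply: Gall; rewrite -/(om b a) omC ab oppr0.
have LaC a b : La a b = - La b a by exact: wedgeC.
(* The vector [om a c *: b - om a b *: c] is [om]-orthogonal to [a]. *)
have exch a b c : om a c *: La a b - om a b *: La a c \in U.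
  have -> : om a c *: La a b - om a b *: La a c = La a (om a c *: b + (- om a b) *: c).
    by rewrite /La mulmxDl -!scalemxAl wedgeP wedgeZ scaleNr.
  apply: La0; rewrite /om dotC dotP dotZ !(dotC _ (a *m W)) -!/(om a _); ring.
move=> Z sZ.
have [m0|m0] := posnP m; first (suff -> : Z = 0 by rewrite mem0v).
  apply/matrixP => i; by have /lt0n_neq0/eqP := leq_ltn_trans (leq0n i) (ltn_ord i).
have [a0 [b0 ab1]] : exists a b, om a b = 1.
  pose i0 := Ordinal m0; pose a := delta_mx 0 i0 *m invmx W : 'rV_m.
  exists a, (delta_mx 0 i0); rewrite /om /a mulmxKV // /dot (bigD1 i0) //= mxE !eqxx mulr1.
  by rewrite big1 ?addr0 // => j /negbTE h; rewrite mxE h andbF mul0r.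
have a00 : a0 *m W != 0.
  apply: contra_eq_neq ab1 => h; rewrite /om h /dot big1 ?(eq_sym 0) ?oner_neq0 // => i _.
  by rewrite mxE mul0r.
have Leq a b : La a b - om a b *: La a0 b0 \in U.
  have [aW|aW] := eqVneq (a *m W) 0.
    rewrite /La /om aW wedgeC wedge0 oppr0.
    by rewrite /dot big1 ?scale0r ?subr0 ?mem0v // => i _; rewrite mxE mul0r.
  (* Modulo [U], exchange [b] for [c], then [a] for [a0], then [c] for [b0]; this divides by
     [om a c] and [om a0 c] only. *)
  have [c [ac a0c]] := two_nonzero aW a00; rewrite -!/(om _ _) in ac a0c.
  have h1 := exch a b c; have h2 := exch c a a0; have h3 := exch a0 c b0.
  rewrite ab1 !(omC c) !(LaC c) in h2 h3.
  have := memvZ (om a c * om a0 c)^-1 (memvD (memvZ (om a0 c) h1)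
    (memvD (memvZ (om a b) h2) (memvZ (om a b * om a c) h3))).
  move: (La a b) (La a c) (La a0 c) (La a0 b0) => u1 u2 u3 u4.
  congr (_ \in U); apply/matrixP => i j; rewrite !mxE.
  by field; rewrite ac a0c.
have half (Y : 'M[F]_m) : 2%:R *: Y \in U -> Y \in U.
  by move=> /(memvZ 2%:R^-1); rewrite scalerA mulVf ?scale1r // pnatr_eq0.
have eW i : delta_mx 0 i = (delta_mx 0 i *m invmx W) *m W :> 'rV_m by rewrite mulmxKV.
have L0U : La a0 b0 \in U.
  (* Expanding [2 W] in wedges of basis vectors gives [2 W = m (La a0 b0)] modulo [U], the factor
     [m] being the trace of [W W^-1]. *)
  pose D i j := W i j *: (La (delta_mx 0 i *m invmx W) (delta_mx 0 j *m invmx W)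
      - om (delta_mx 0 i *m invmx W) (delta_mx 0 j *m invmx W) *: La a0 b0).
  have : \sum_i \sum_j D i j \in U.
    by apply: memv_suml => i _; apply: memv_suml => j _; apply: memvZ.
  have -> : \sum_i \sum_j D i j = 2%:R *: W - m%:R *: La a0 b0.
    rewrite skew_sum //.
    have -> : m%:R = \sum_i \sum_j
        W i j * om (delta_mx 0 i *m invmx W) (delta_mx 0 j *m invmx W).
      have -> : m%:R = \tr (W *m invmx W) :> F by rewrite mulmxV // mxtrace1.
      rewrite /mxtrace; apply: eq_bigr => i _; rewrite mxE; apply: eq_bigr => j _.
      congr (_ * _); rewrite /om mulmxKV // -rowE /dot (bigD1 i) //= !mxE !eqxx mul1r.
      by rewrite big1 ?addr0 // => l /negbTE li; rewrite mxE li andbF mul0r.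
    rewrite scaler_suml -sumrB; apply: eq_bigr => i _.
    rewrite scaler_suml -sumrB; apply: eq_bigr => j _.
    by rewrite /D scalerBr scalerA /La -!eW.
  move=> /(memvB (memvZ 2%:R UW)); rewrite subKr => /(memvZ m%:R^-1).
  by rewrite scalerA mulVf ?scale1r // pnatr_eq0 -lt0n.
have Lall a b : La a b \in U.
  by have := memvD (Leq a b) (memvZ (om a b) L0U); rewrite subrK.
apply: half; rewrite skew_sum //.
by apply: memv_suml => i _; apply: memv_suml => j _; rewrite memvZ // (eW i) (eW j) Lall.
Qed.

(** * Rational span of a matrix *)

Lemma common_denominator (I : finType) (f : I -> rat) :
  exists2 D : int, D != 0 & exists z : I -> int, forall i, D%:~R * f i = (z i)%:~R.
Proof.
exists (\prod_i denq (f i)); first by apply/prodf_neq0 => i _; exact: denq_neq0.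
exists (fun i => numq (f i) * \prod_(j | j != i) denq (f j)) => i.
rewrite (bigD1 i) //= !intrM mulrAC; congr (_ * _).
by rewrite numqE mulrC.
Qed.

(** The determinant of [y A + B] is a polynomial in [y], nonzero at [x]; it has too few roots to
    vanish at every natural number. *)
Lemma unitmx_pencil (R : numFieldType) m (A B : 'M[R]_m) (x : R) :
  x *: A + B \in unitmx -> exists n : nat, n%:R *: A + B \in unitmx.
Proof.
pose p := \det ('X *: map_mx polyC A + map_mx polyC B).
have pE y : p.[y] = \det (y *: A + B).
  rewrite -[p.[y]]/(horner_eval y p) /p -det_map_mx; congr (\det _).
  by apply/matrixP => i j; rewrite !mxE /= /horner_eval !hornerE.
rewrite unitmxE unitfE -pE => px.
have p0 : p != 0 by apply: contra_neq px => ->; rewrite horner0.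
apply: contrapT => h.
have := max_poly_roots p0 (rs := [seq n%:R | n <- iota 0 (size p)]).
rewrite size_map size_iota ltnn => H; apply: notF; apply: H.
  apply/allP => _ /mapP[n _ ->]; rewrite /root pE; apply/negPn/negP => hn.
  by apply: h; exists n; rewrite unitmxE unitfE.
by rewrite map_inj_uniq ?iota_uniq // => i j /eqP; rewrite eqr_nat => /eqP.
Qed.

(* A nonzero polynomial does not vanish at all natural numbers; one coordinate at a time. *)
Lemma unitmx_span_nat (R : numFieldType) m (I : finType) (x : I -> R) (M : I -> 'M[R]_m) :
  \sum_i x i *: M i \in unitmx ->
  exists c : I -> nat, \sum_i (c i)%:R *: M i \in unitmx.
Proof.
move=> xu.
suff H (s : seq I) : exists2 c : I -> R, forall i, i \in s -> exists n : nat, c i = n%:R &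
    \sum_i c i *: M i \in unitmx.
  have [c cn cu] := H (enum I).
  have /choice[n nE] : forall i, exists n : nat, c i = n%:R.
    by move=> i; apply: cn; rewrite mem_enum.
  by exists n; under eq_bigr do rewrite -nE.
elim: s => [|j s [c cn cu]]; first by exists x.
rewrite (bigD1 j) //= in cu; have [n nu] := unitmx_pencil cu.
exists (fun i => if i == j then n%:R else c i).
  by move=> i; rewrite inE; case: eqP => [_ _|_ /= /cn //]; exists n.
rewrite (bigD1 j) //= eqxx; congr (_ + _ \in unitmx): nu.
by apply: eq_bigr => i /negbTE ->.
Qed.

Definition hull m (I : finType) (M : I -> 'M[int]_m) : {vspace 'M[rat]_m} :=
  <<[seq map_mx intr (M i) | i : I]>>%VS.

Lemma mem_hull m (I : finType) (M : I -> 'M[int]_m) i : map_mx intr (M i) \in hull M.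
Proof. by apply/memv_span/mapP; exists i; rewrite ?mem_enum. Qed.

Lemma hullP m (I : finType) (M : I -> 'M[int]_m) A : A \in hull M ->
  exists c : I -> rat, A = \sum_i c i *: map_mx intr (M i).
Proof.
move=> /(coord_span (X := codom_tuple (fun i => map_mx intr (M i)))) AE.
exists (fun i => coord (codom_tuple (fun i => map_mx intr (M i))) (enum_rank i) A).
rewrite {1}AE (reindex (@enum_rank I)) /=; last exact: onW_bij (enum_rank_bij _).
by apply: eq_bigr => i _; rewrite nth_codom enum_rankK.
Qed.

(** Independence of [al] makes [hull M] the smallest rational subspace whose real span contains
    [T]. *)
Definition expansion (R : realType) m (I : finType) (al : I -> R) (M : I -> 'M[int]_m)
    (T : 'M[R]_m) :=
  [/\ rat_free al, forall i, skewmx (M i) & T = \sum_i al i *: map_mx intr (M i)].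

(** A limit could degenerate; the real congruence [g] keeps it invertible and ties it to the
    original form. *)
Definition treach (R : realType) m (T T' : 'M[R]_m) :=
  reach T T' /\ exists2 g, g \in unitmx & T' = congr_mx g T.

Lemma treach_trans (R : realType) m (T1 T2 T3 : 'M[R]_m) :
  treach T1 T2 -> treach T2 T3 -> treach T1 T3.
Proof.
move=> [r12 [g gu E2]] [r23 [h hu E3]]; split; first exact: reach_trans r12 r23.
by exists (g *m h); rewrite ?unitmx_mul ?gu // E3 E2 congr_mxM.
Qed.

(** * Enlarging the rational span *)

Lemma map_wedge (R : comPzRingType) m (x y : 'rV[int]_m) :
  map_mx intr (wedge x y) = wedge (map_mx intr x) (map_mx intr y) :> 'M[R]_m.
Proof. by apply/matrixP => i j; rewrite wedgeE mxE wedgeE !mxE rmorphB !rmorphM. Qed.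

Lemma map_skew (R : comPzRingType) m (M : 'M[int]_m) :
  skewmx M -> skewmx (map_mx intr M : 'M[R]_m).
Proof. by rewrite /skewmx => sM; rewrite map_trmx sM map_mxN. Qed.

(** A bad [t] is a quotient of two elements of the rational span of [al], and these quotients are
    countably many. *)
Lemma rat_free_extend (R : realType) (I : finType) (al : I -> R) : rat_free al ->
  exists2 t : R, t != 0 &
   rat_free (fun x : I + I => match x with inl i => al i | inr i => t * al i end).
Proof.
move=> Hal.
pose ev (p : {ffun I -> rat}) := \sum_i ratr (p i) * al i.
pose F (pq : {ffun I -> rat} * {ffun I -> rat}) := - ev pq.1 / ev pq.2.
have [t /andP[t0 _] Ht] := avoid_countable F (ltr01 : 0 < 1 :> R).
exists t; first by rewrite gt_eqF.
move=> c; rewrite big_sumType /= => Hc.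
pose p : {ffun I -> rat} := [ffun i => c (inl i)].
pose q : {ffun I -> rat} := [ffun i => c (inr i)].
have {Hc} E : ev p + t * ev q = 0.
  rewrite -[RHS]Hc /ev mulr_sumr; congr (_ + _); apply: eq_bigr => i _; rewrite ffunE //.
  by rewrite mulrCA.
have [q0|q0] := eqVneq (ev q) 0; last first.
  have /eqP[] := Ht (p, q); rewrite /F /=.
  have -> : ev p = - (t * ev q) by apply/eqP; rewrite -addr_eq0 E.
  by rewrite opprK mulfK.
have p0 : ev p = 0 by rewrite -E q0 mulr0 addr0.
by case=> i; [have := Hal _ p0 i | have := Hal _ q0 i]; rewrite ffunE.
Qed.

(** By Kronecker's theorem the line through [f = v^T T] comes close to [t v^T M_a] modulo integer
    vectors, so [T + f /\ (t v^T M_a)] is a limit. Its new terms have coefficients [t al_i] and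
    matrices [(v^T M_i) /\ (v^T M_a)]; the one with [i = b] lies outside the old span. *)
Lemma expansion_grow (R : realType) m (I : finType) (al : I -> R) (M : I -> 'M[int]_m)
    (T : 'M[R]_m) (v : 'cV[int]_m) (a b : I) :
  expansion al M T ->
  map_mx intr (wedge (v^T *m M b) (v^T *m M a)) \notin hull M ->
  exists (J : finType) (be : J -> R) (N : J -> 'M[int]_m) (T' : 'M[R]_m),
    [/\ treach T T', expansion be N T' & (\dim (hull M) < \dim (hull N))%N].
Proof.
move=> [Hal sM TE] nin.
have [t t0 Hbe] := rat_free_extend Hal.
pose r i := v^T *m M i; pose rR i : 'rV[R]_m := map_mx intr (r i).
pose be (x : I + I) := match x with inl i => al i | inr i => t * al i end.
pose N (x : I + I) := match x with inl i => M i | inr i => wedge (r i) (r a) end.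
pose f := (map_mx intr v)^T *m T.
have fE : f = \sum_i al i *: rR i.
  rewrite /f TE mulmx_sumr; apply: eq_bigr => i _.
  by rewrite -scalemxAr /rR /r map_mxM map_trmx.
have sT : skewmx T.
  rewrite /skewmx TE linear_sum /= -sumrN; apply: eq_bigr => i _.
  by rewrite linearZ /= (map_skew _ (sM i)) scalerN.
pose T' := T + wedge f (t *: rR a).
exists (I + I)%type, be, N, T'; split.
- split.
    apply: reach_shift => // e e0.
    pose F : R := \sum_i \sum_j `|rR i 0 j|.
    have F0 : 0 < F + 1 by apply: ltr_wpDl => //; apply: sumr_ge0 => i _; apply: sumr_ge0.
    have d0 : 0 < e / (F + 1) by apply: divr_gt0.
    have [s [l Hl]] := kronecker Hal (fun i => t * (i == a)%:R) d0.
    exists s, (\sum_i l i *: r i) => i j; rewrite ord1 {i}.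
    have -> : (s *: ((map_mx intr v)^T *m T) - t *: rR a) 0 j -
        map_mx intr (\sum_i l i *: r i) 0 j =
        \sum_i (s * al i - t * (i == a)%:R - (l i)%:~R) * rR i 0 j.
      have e1 : (\sum_i al i *: rR i) 0 j = \sum_i al i * rR i 0 j.
        by rewrite summxE; apply: eq_bigr => i _; rewrite [LHS]mxE.
      have e2 : map_mx intr (\sum_i l i *: r i) 0 j = \sum_i (l i)%:~R * rR i 0 j.
        rewrite mxE summxE rmorph_sum; apply: eq_bigr => i _ /=.
        by rewrite [in LHS]mxE intrM /rR [in RHS]mxE.
      rewrite e2 -/f fE [X in X - _]mxE [X in X + _ - _]mxE e1.
      rewrite [X in _ + X - _]mxE [X in _ - X - _]mxE.
      rewrite [t * _](_ : _ = \sum_i t * (i == a)%:R * rR i 0 j); last first.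
        rewrite (bigD1 a) //= eqxx mulr1 big1 ?addr0 // => i /negbTE ->.
        by rewrite mulr0 mul0r.
      by rewrite mulr_sumr -!sumrB; apply: eq_bigr => i _; ring.
    set d : R := e / (F + 1) in d0 Hl.
    have de : e = d * (F + 1) by rewrite divfK // gt_eqF.
    apply: (@le_lt_trans _ _ (d * F)); last by rewrite de ltr_pM2l // ltrDl.
    apply: le_trans (ler_norm_sum _ _ _) _; rewrite mulr_sumr; apply: ler_sum => i _.
    rewrite normrM; apply: ler_pM => //; first exact: ltW.
    by rewrite (bigD1 j) //= lerDl sumr_ge0.
  (* Since [(v^T M_a) v = 0], the real transvection that carries [T] exactly to [T'] is
     invertible. *)
  have rv : rR a *m map_mx intr v = 0.
    rewrite /rR /r -map_mxM -[RHS](map_mx0 (intr : int -> R)); congr map_mx.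
    exact: skew_quad.
  exists (1%:M + map_mx intr v *m (- t *: rR a)).
    by apply: unitmx_transvection; rewrite -scalemxAl rv scaler0.
  by rewrite congr_transvection // -/f scaleNr -scaleN1r wedgeZ scaleN1r opprK.
- split=> //; first by case=> i /=; [exact: sM | exact: wedge_skew].
  rewrite big_sumType /= -TE /T'; congr (_ + _); rewrite wedgeC fE.
  rewrite wedge_sum -sumrN; apply: eq_bigr => i _.
  by rewrite map_wedge -/(rR i) -/(rR a) [in LHS]wedgeC wedgeZ scalerN opprK scalerA mulrC.
- have sub : (hull M <= hull N)%VS.
    apply/span_subvP => _ /mapP[i _ ->]; exact: (mem_hull N (inl i)).
  rewrite ltn_neqAle dimvS // andbT; apply: contraNneq nin => eqd.
  have /eqP -> : hull M == hull N by rewrite eqEdim sub eqd /=.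
  exact: (mem_hull N (inr b)).
Qed.

(** Bilinearity reduces [A] and [B] to generators, and clearing denominators makes [v] integral. *)
Lemma hull_closed m (I : finType) (M : I -> 'M[int]_m) :
  (forall (v : 'cV[int]_m) a b,
     map_mx intr (wedge (v^T *m M b) (v^T *m M a)) \in hull M) ->
  forall A B (v : 'rV[rat]_m), A \in hull M -> B \in hull M ->
    wedge (v *m A) (v *m B) \in hull M.
Proof.
move=> H A B v /hullP[c ->] /hullP[d ->].
have [D D0 [z zE]] := common_denominator (fun j => v 0 j).
have vE : v = D%:~R^-1 *: map_mx intr (\row_j z j).
  by apply/rowP => j; rewrite !mxE -zE mulKf // intr_eq0.
rewrite !mulmx_sumr.
under [X in wedge _ X]eq_bigr do rewrite -scalemxAr.
rewrite wedge_sum; apply: memv_suml => j _; apply: memvZ; rewrite wedgeC memvN.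
under [X in wedge _ X]eq_bigr do rewrite -scalemxAr.
rewrite wedge_sum; apply: memv_suml => i _; apply: memvZ.
rewrite vE -!scalemxAl wedgeZ memvZ // wedgeC memvN wedgeZ memvZ //.
have := H (\row_j z j)^T i j; rewrite map_wedge !map_mxM trmxK.
by rewrite wedgeC memvN wedgeC memvN.
Qed.

(** All [M i] are rational multiples of one matrix, whose denominators move into the real factor. *)
Lemma expansion_dim1 (R : realType) m (I : finType) (al : I -> R) (M : I -> 'M[int]_m)
    (T : 'M[R]_m) : expansion al M T -> (\dim (hull M) <= 1)%N ->
  exists (c : R) (w : 'M[int]_m), T = c *: map_mx intr w.
Proof.
move=> [_ _ TE] d1.
have [w wE] : exists w, forall i, exists c : rat, map_mx intr (M i) = c *: w.
  have [h|h] := pselect (forall i, M i = 0).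
    by exists 0 => i; exists 0; rewrite h map_mx0 scaler0.
  have [i Mi] : exists i, M i != 0.
    apply: contrapT => hn; apply: h => i; apply/eqP; apply: contrapT => Mi.
    by apply: hn; exists i; apply/negP.
  exists (map_mx intr (M i)) => j; apply/vlineP.
  have Mi0 : map_mx intr (M i) != 0 :> 'M[rat]_m.
    apply: contra_neq Mi => /matrixP h0; apply/matrixP => a b.
    by have /eqP := h0 a b; rewrite !mxE intr_eq0 => /eqP.
  have sub : (<[(map_mx intr (M i) : 'M[rat]_m)]> <= hull M)%VS.
    by rewrite -memvE mem_hull.
  have /eqP -> : <[(map_mx intr (M i) : 'M[rat]_m)]>%VS == hull M.
    by rewrite eqEdim sub dim_vline Mi0.
  exact: mem_hull.
have /choice[c cE] := wE.
have [D D0 [z zE]] := common_denominator (fun ab : 'I_m * 'I_m => w ab.1 ab.2).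
exists (\sum_i al i * ratr (c i) / D%:~R), (\matrix_(i, j) z (i, j)).
rewrite TE scaler_suml; apply: eq_bigr => i _; apply/matrixP => a b.
have := congr1 (fun Q : 'M[rat]_m => ratr (Q a b) : R) (cE i).
rewrite !mxE rmorphM /= ratr_int => ->.
have /(congr1 (ratr : rat -> R)) := zE (a, b); rewrite /= rmorphM /= !ratr_int => <-.
by field; rewrite intr_eq0.
Qed.

(** Induction on the bound [d] for the codimension of the span in all matrices: either a wedge
    enlarges the span, or the span is closed and [wedge_closed_full] applies. *)
Lemma expansion_saturate (R : realType) m (d : nat) (I : finType) (al : I -> R)
    (M : I -> 'M[int]_m) (T : 'M[R]_m) :
  expansion al M T -> T \in unitmx -> (1 < \dim (hull M))%N ->
  (m * m <= \dim (hull M) + d)%N ->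
  exists (J : finType) (be : J -> R) (N : J -> 'M[int]_m) (T' : 'M[R]_m),
    [/\ treach T T', expansion be N T' & forall Z, skewmx Z -> Z \in hull N].
Proof.
elim: d I al M T => [|d IH] I al M T ex uT d1 dle.
  exists I, al, M, T; split=> //.
    by split; [exact: reach_refl | exists 1%:M; rewrite ?unitmx1 ?congr_mx1].
  move=> Z _; suff -> : hull M = fullv by rewrite memvf.
  by apply/eqP; rewrite eqEdim subvf dimvf /dim /=; rewrite addn0 in dle.
have [cl|ncl] := pselect (forall (v : 'cV[int]_m) a b,
    map_mx intr (wedge (v^T *m M b) (v^T *m M a)) \in hull M).
  exists I, al, M, T; split=> //.
    by split; [exact: reach_refl | exists 1%:M; rewrite ?unitmx1 ?congr_mx1].
  have [_ sM TE] := ex.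
  (* The real combination [T] of the [M i] is invertible, hence so is one with natural coefficients;
     the latter lies in the rational span. *)
  have [n nu] : exists n : I -> nat,
      \sum_i (n i)%:R *: (map_mx intr (M i) : 'M[R]_m) \in unitmx.
    by apply: (@unitmx_span_nat _ _ _ al); rewrite -TE.
  pose W : 'M[rat]_m := \sum_i (n i)%:R *: map_mx intr (M i).
  have WU : W \in hull M by apply: memv_suml => i _; apply: memvZ; exact: mem_hull.
  have [S SU nS] : exists2 S, S \in hull M & forall c, S <> c *: W.
    apply: contrapT => h; suff /dimvS : (hull M <= <[W]>)%VS.
      by rewrite dim_vline; case: (W != 0); move: d1; lia.
    apply/subvP => S SU; apply/vlineP; apply: contrapT => hS; apply: h.
    by exists S => // c Sc; apply: hS; exists c.
  apply: (wedge_closed_full (hull_closed cl) WU SU _ _ nS).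
    rewrite -(map_unitmx (ratr : rat -> R)) rmorph_sum /=.
    congr (_ \in unitmx): nu; apply: eq_bigr => i _.
    by apply/matrixP => a b; rewrite !mxE rmorphM /= ratr_int ratr_nat.
  rewrite /skewmx linear_sum /= -sumrN; apply: eq_bigr => i _.
  by rewrite linearZ /= (map_skew _ (sM i)) scalerN.
have {ncl} [v [a [b nin]]] : exists v a b,
    map_mx intr (wedge (v^T *m M b) (v^T *m M a)) \notin hull M.
  apply: contrapT => h; apply: ncl => v a b; apply/negPn/negP => hh.
  by apply: h; exists v, a, b.
have [J [be [N [T' [tT' ex' dlt]]]]] := expansion_grow ex nin.
have uT' : T' \in unitmx.
  by have [_ [g ug ->]] := tT'; rewrite !unitmx_mul unitmx_tr ug uT.
have [||J' [be' [N' [T2 [t2 e2 f2]]]]] := IH J be N T' ex' uT'.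
- exact: ltn_trans dlt.
- by lia.
by exists J', be', N', T2; split=> //; exact: treach_trans t2.
Qed.

(** * Existence of expansions, and independence within rows *)

Lemma rational_basis (R : realType) (s : seq R) :
  exists (I : finType) (al : I -> R), rat_free al /\
    forall x, x \in s -> exists c : I -> rat, x = \sum_i ratr (c i) * al i.
Proof.
elim: s => [|x s [I [al [Hal Hs]]]].
  by exists void, (fun=> 0); split=> // c _ [].
have [xin|xn] := pselect (exists c : I -> rat, x = \sum_i ratr (c i) * al i).
  by exists I, al; split=> // y; rewrite inE => /orP[/eqP->|/Hs].
exists (option I), (fun o => if o is Some i then al i else x); split.
  move=> c Hc.
  have sE : \sum_i ratr (c i) * (if i is Some i' then al i' else x) =
      ratr (c None) * x + \sum_i ratr (c (Some i)) * al i.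
    rewrite (bigD1 None) //=; congr (_ + _).
    rewrite (reindex_omap Some id) //=; last by case.
    by apply: eq_bigl => i; rewrite eqxx.
  rewrite sE in Hc.
  have [c0|c0] := eqVneq (c None) 0.
    rewrite c0 rmorph0 mul0r add0r in Hc.
    by case=> [i|//]; exact: (Hal (fun i => c (Some i))).
  case: xn; exists (fun i => - c (Some i) / c None).
  have rc : ratr (c None) != 0 :> R by rewrite fmorph_eq0.
  apply: (mulfI rc); rewrite mulr_sumr.
  have -> : ratr (c None) * x = - \sum_i ratr (c (Some i)) * al i.
    by apply/eqP; rewrite -addr_eq0 Hc.
  rewrite -sumrN; apply: eq_bigr => i _.
  by rewrite fmorph_div rmorphN /=; field.
move=> y; rewrite inE => /orP[/eqP->|/Hs[c ->]].
  exists (fun o => (o == None)%:R); rewrite (bigD1 None) //= rmorph1 mul1r big1 ?addr0 //.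
  by move=> [i|//] _; rewrite rmorph0 mul0r.
exists (fun o => if o is Some i then c i else 0).
rewrite (bigD1 None) //= rmorph0 mul0r add0r.
rewrite [RHS](reindex_omap Some id) //=; last by case.
by apply: eq_bigl => i; rewrite eqxx.
Qed.

(** Expand the entries of [T] in a rational basis and move a common denominator into [al]; skewness
    of [T] passes to each [M i] by independence. *)
Lemma expansion_exists (R : realType) m (T : 'M[R]_m) : skewmx T ->
  exists (I : finType) (al : I -> R) (M : I -> 'M[int]_m), expansion al M T.
Proof.
move=> sT.
have [I [al [Hal Hs]]] := rational_basis [seq T ij.1 ij.2 | ij <- enum {: 'I_m * 'I_m}].
have /choice[c cE] : forall ij : 'I_m * 'I_m, exists c : I -> rat,
    T ij.1 ij.2 = \sum_i ratr (c i) * al i.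
  by move=> ij; apply: Hs; apply/mapP; exists ij; rewrite ?mem_enum.
have [D D0 [z zE]] := common_denominator (fun x : ('I_m * 'I_m) * I => c x.1 x.2).
have DR : D%:~R != 0 :> R by rewrite intr_eq0.
exists I, (fun i => al i / D%:~R), (fun i => \matrix_(a, b) z ((a, b), i)); split.
- move=> q Hq i; have : ratr (q i) = 0 :> R.
    rewrite (Hal q) ?rmorph0 //; apply: (mulIf (_ : D%:~R^-1 != 0 :> R)).
      by rewrite invr_eq0.
    by rewrite mul0r mulr_suml -[RHS]Hq; apply: eq_bigr => j _; rewrite mulrA.
  by move/eqP; rewrite fmorph_eq0 => /eqP.
- move=> i; apply/matrixP => a b; rewrite !mxE.
  have h : c (b, a) i + c (a, b) i = 0.
    apply: (Hal (fun i => c (b, a) i + c (a, b) i)).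
    under eq_bigr do rewrite rmorphD mulrDl.
    rewrite big_split /= -(cE (b, a)) -(cE (a, b)) /=.
    by have := congr1 (fun Q : 'M[R]_m => Q a b) sT; rewrite !mxE => ->; rewrite addNr.
  apply/eqP; rewrite -addr_eq0 -(intr_eq0 rat) intrD -!zE /= -mulrDr h mulr0 //.
- apply/matrixP => a b; rewrite summxE (cE (a, b)); apply: eq_bigr => i _.
  rewrite !mxE; have /(congr1 (ratr : rat -> R)) := zE ((a, b), i).
  by rewrite /= rmorphM /= !ratr_int => <-; field.
Qed.

(** The diagonal coefficient [z i] is left free because a skew [T] has [T i i = 0]. *)
Definition rowfree (R : realType) m (T : 'M[R]_m) :=
  forall i (z : 'I_m -> rat), \sum_j ratr (z j) * T i j = 0 -> forall j, j != i -> z j = 0.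

(** A rational relation in row [i] of [T] holds in row [i] of every [M a], hence of every rational
    skew matrix; test it on [e_i /\ e_j]. *)
Lemma expansion_rowfree (R : realType) m (I : finType) (al : I -> R)
    (M : I -> 'M[int]_m) (T : 'M[R]_m) :
  expansion al M T -> (forall Z, skewmx Z -> Z \in hull M) -> rowfree T.
Proof.
move=> [Hal _ TE] full i z Hz j ji.
have h a : \sum_l z l * (M a i l)%:~R = 0.
  apply: (Hal (fun a => \sum_l z l * (M a i l)%:~R)); rewrite -[RHS]Hz.
  under eq_bigr do rewrite rmorph_sum mulr_suml /=.
  rewrite exchange_big /=; apply: eq_bigr => l _.
  rewrite TE summxE mulr_sumr; apply: eq_bigr => b _.
  by rewrite !mxE rmorphM /= ratr_int; ring.
have /hullP[c cE] := full _ (wedge_skew (delta_mx 0 i) (delta_mx 0 j)).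
have : \sum_l z l * wedge (delta_mx 0 i) (delta_mx 0 j) i l = 0.
  rewrite cE; transitivity (\sum_a c a * \sum_l z l * (M a i l)%:~R).
    under [RHS]eq_bigr do rewrite mulr_sumr.
    rewrite [RHS]exchange_big /=; apply: eq_bigr => l _.
    rewrite summxE mulr_sumr; apply: eq_bigr => a _; rewrite !mxE; ring.
  by rewrite big1 // => a _; rewrite h mulr0.
rewrite (bigD1 j) //= big1 => [|l /negbTE lj].
  by rewrite addr0 wedgeE !mxE !eqxx (eq_sym i) (negbTE ji) mul0r subr0 !mulr1.
by rewrite wedgeE !mxE !eqxx lj (eq_sym i) (negbTE ji) /= mulr0 mul0r subr0 mulr0.
Qed.

(** * Real elementary congruences *)

Definition good (R : realType) m (T0 T : 'M[R]_m) := [/\ reach T0 T, skewmx T & rowfree T].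

(** Shears with a generic parameter preserve [good]; passing to the closure admits every real
    parameter. *)
Definition good_limit (R : realType) m (T0 T : 'M[R]_m) :=
  forall e, 0 < e -> exists2 T1, good T0 T1 & close e T1 T.

(** Multiplying [h] by it on the right adds [h *m w] to column [a] of [h]. *)
Definition shear (R : comPzRingType) m (w : 'cV[R]_m) (a : 'I_m) : 'M[R]_m :=
  1%:M + w *m delta_mx 0 a.

(** The off-diagonal entries of row [i] are independent, so by Kronecker's theorem real multiples of
    that row come close to [- t e_k] modulo integer vectors. *)
Lemma good_elementary (R : realType) m (T0 T : 'M[R]_m) (i k : 'I_m) (a b : R) :
  good T0 T -> i != k -> a < b ->
  exists2 t, a < t < b &
    good T0 (congr_mx (shear (t *: delta_mx i 0) k) T).
Proof.
move=> [rT sT fT] ik ab.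
pose f := (map_mx intr (delta_mx i 0 : 'cV[int]_m))^T *m T.
have fE j : f 0 j = T i j.
  by rewrite /f map_delta_mx trmx_delta -rowE mxE.
pose W := wedge f (delta_mx 0 k).
pose A (x : 'I_m * {ffun 'I_m -> rat}) := \sum_l ratr (x.2 l) * T x.1 l.
pose B (x : 'I_m * {ffun 'I_m -> rat}) := \sum_l ratr (x.2 l) * W x.1 l.
(* A relation [z] in row [j] of the new matrix reads [A = t * B]. Avoiding all quotients [A / B]
   forces [B = 0], hence [A = 0], a relation in row [j] of [T]. *)
have [t tab tF] := avoid_countable (fun x => A x / B x) ab.
exists t => //.
have TE : congr_mx (shear (t *: delta_mx i 0) k) T = T + wedge f (- t *: delta_mx 0 k).
  rewrite /shear -scalemxAl scalemxAr congr_transvection //.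
  have -> : (delta_mx i 0)^T *m T = f by rewrite /f map_delta_mx.
  by rewrite !wedgeZ scaleNr.
rewrite TE; split.
- apply: reach_trans rT _; apply: reach_shift => // e e0.
  have Tii : T i i = 0.
    have := congr1 (fun Q : 'M[R]_m => Q i i) sT; rewrite !mxE; lra.
  have Hq : rat_free (fun j : {j : 'I_m | j != i} => T i (val j)).
    move=> c Hc j.
    pose z (l : 'I_m) : rat := if insub l is Some j' then c j' else 0.
    have zE j' : z (val j') = c j' by rewrite /z valK.
    rewrite -zE; apply: (fT i) (valP j).
    rewrite (bigD1 i) //= Tii mulr0 add0r -[RHS]Hc.
    rewrite (reindex_omap (val : {j : 'I_m | j != i} -> 'I_m) insub) /=; last first.
      by move=> l li; rewrite insubT.
    by apply: eq_big => [l|l _]; [rewrite valK eqxx (valP l) | rewrite zE].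
  have [s [l Hl]] := kronecker Hq (fun j => - t * (val j == k)%:R) e0.
  exists s, (\row_j if insub j is Some j' then l j' else 0) => x j; rewrite ord1 {x}.
  have entry (F : 'rV[R]_m) :
      (s *: F - - t *: delta_mx 0 k) 0 j = s * F 0 j - - t * (j == k)%:R.
    by rewrite !mxE eqxx.
  rewrite entry -/f fE.
  rewrite !mxE; case: insubP => [j' ji <-|]; first exact: Hl.
  by rewrite negbK => /eqP ->; rewrite Tii (negbTE ik) !mulr0 !subrr normr0.
- rewrite -TE; exact: congr_skew.
- move=> j z Hz; apply: fT.
  pose x := (j, [ffun l => z l]).
  have E : A x - t * B x = 0.
    rewrite -[RHS]Hz /A /B mulr_sumr -sumrB; apply: eq_bigr => l _ /=.
    by rewrite ffunE wedgeZ [in RHS]mxE [X in _ * (_ + X)]mxE; ring.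
  have Bx : B x = 0.
    apply/eqP; apply: contraT => Bn; case/eqP: (tF x).
    by rewrite (_ : A x = t * B x) ?mulfK //; move: E; lra.
  by rewrite Bx mulr0 subr0 in E; rewrite -[RHS]E; apply: eq_bigr => l _; rewrite ffunE.
Qed.

(** Take a good [T1] near [T] and a generic parameter [s] slightly above [t]; the congruence is
    affine in [s]. *)
Lemma good_limit_elementary (R : realType) m (T0 T : 'M[R]_m) (i k : 'I_m) (t : R) :
  good_limit T0 T -> i != k ->
  good_limit T0 (congr_mx (shear (t *: delta_mx i 0) k) T).
Proof.
move=> H ik e e0.
have e2 : 0 < e / 2 by lra.
have [d d0 Hd] := close_congr (shear (t *: delta_mx i 0) k) e2.
have [T1 g1 c1] := H d d0.
have sT1 : skewmx T1 by case: g1.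
pose W := wedge ((delta_mx i 0)^T *m T1) (delta_mx 0 k).
have WE s : congr_mx (shear (s *: delta_mx i 0) k) T1 = T1 - s *: W.
  by rewrite /shear -scalemxAl scalemxAr congr_transvection // wedgeZ.
pose K : R := \sum_x \sum_y `|W x y|.
have Kle x y : `|W x y| <= K.
  rewrite /K (bigD1 x) //= (bigD1 y) //= -addrA lerDl addr_ge0 ?sumr_ge0 // => u _.
  by rewrite sumr_ge0.
have K0 : 0 < K + 1 by rewrite ltr_wpDl // sumr_ge0 // => x _; rewrite sumr_ge0.
have dl0 : 0 < e / 2 / (K + 1) by rewrite divr_gt0.
have [|s /andP[s1 s2] gs] := good_elementary (a := t) (b := t + e / 2 / (K + 1)) g1 ik.
  by rewrite ltrDl.
exists (congr_mx (shear (s *: delta_mx i 0) k) T1) => //.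
apply: (close_trans (e1 := e / 2) _ _ (Hd _ _ c1)); first by rewrite -splitr.
rewrite !WE; clearbody W => x y; rewrite !mxE.
have -> : T1 x y - s * W x y - (T1 x y - t * W x y) = - ((s - t) * W x y) by ring.
rewrite normrN normrM gtr0_norm ?subr_gt0 //.
apply: (@le_lt_trans _ _ ((s - t) * K)); first by rewrite ler_wpM2l // subr_ge0 ltW.
have st : 0 < s - t by rewrite subr_gt0.
apply: (@lt_trans _ _ ((s - t) * (K + 1))); first by rewrite ltr_pM2l // ltrDl.
by rewrite -ltr_pdivlMr // ltrBlDl.
Qed.

(** Shears into the same column [a] by vectors vanishing at [a] compose by adding the vectors, so
    [w] splits into its coordinates. *)
Lemma good_limit_column (R : realType) m (T0 T : 'M[R]_m) (w : 'cV[R]_m) (a : 'I_m) :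
  w a 0 = 0 -> good_limit T0 T ->
  good_limit T0 (congr_mx (shear w a) T).
Proof.
move=> wa; pose P (w : 'cV[R]_m) := w a 0 = 0 /\ forall T, good_limit T0 T ->
  good_limit T0 (congr_mx (shear w a) T).
have : P (\sum_i w i 0 *: delta_mx i 0).
  apply: big_ind; rewrite /P.
  - by rewrite mxE; split=> // T'; rewrite /shear mul0mx addr0 congr_mx1.
  - move=> x y [xa xP] [ya yP]; rewrite mxE xa ya addr0; split=> // T' /xP /yP.
    rewrite congr_mxM /shear mulmxDl mul1mx !mulmxDr mulmx1.
    have -> : x *m delta_mx 0 a *m (y *m delta_mx 0 a) = 0.
      rewrite -!mulmxA (mulmxA (delta_mx 0 a)) -rowE.
      suff -> : row a y = 0 by rewrite mul0mx mulmx0.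
      by apply/matrixP => u v; rewrite !ord1 !mxE.
    by rewrite addr0 mulmxDl addrA addrAC.
  - move=> i _; have [->|ia] := eqVneq i a.
      by rewrite wa scale0r mxE; split=> // T'; rewrite /shear mul0mx addr0 congr_mx1.
    split; first by rewrite !mxE eq_sym (negbTE ia) mulr0.
    by move=> T' gT; apply: good_limit_elementary.
suff <- : w = \sum_i w i 0 *: delta_mx i 0 by case=> _; apply.
apply/colP => i; rewrite summxE (bigD1 i) //= !mxE !eqxx mulr1.
by rewrite big1 ?addr0 // => j /negbTE ji; rewrite !mxE eq_sym ji mulr0.
Qed.

Lemma addmxE (R : nmodType) p q (A B : 'M[R]_(p, q)) i j : (A + B) i j = A i j + B i j.
Proof. by rewrite mxE. Qed.

Lemma oppmxE (R : zmodType) p q (A : 'M[R]_(p, q)) i j : (- A) i j = - A i j.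
Proof. by rewrite mxE. Qed.

Lemma scalemxE (R : pzRingType) p q c (A : 'M[R]_(p, q)) i j : (c *: A) i j = c * A i j.
Proof. by rewrite mxE. Qed.

(* Given an invertible [h] and a last index [jb], put [h u' = X_a - h_a] with [u'_b <> 0] (up
   to a small perturbation).  Adding [u'_a / u'_b] times column [a] to column [jb] first lets a
   combination of the columns other than [a] turn [h_a] into [X_a]. *)
Lemma good_limit_frame (R : realType) m (T0 T : 'M[R]_m.+1) (X : 'M[R]_m.+1) (e : R)
    (a : nat) : good_limit T0 T -> 0 < e -> (a <= m)%N ->
  exists2 h, good_limit T0 (congr_mx h T) &
    h \in unitmx /\ forall i (j : 'I_m.+1), (j < a)%N -> `|h i j - X i j| < e.
Proof.
move=> gT e0; elim: a => [_|a IH am].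
  by exists 1%:M; rewrite ?congr_mx1 // unitmx1.
have [h gh [uh hX]] := IH (ltnW am).
pose ja : 'I_m.+1 := Ordinal (ltnW am : (a < m.+1)%N); pose jb : 'I_m.+1 := ord_max.
have ab : ja != jb by rewrite -val_eqE /= ltn_eqF.
pose u := invmx h *m (col ja X - col ja h).
pose K : R := \sum_i `|h i jb|.
have K0 : 0 < K + 1 by rewrite ltr_wpDl // sumr_ge0.
(* This makes coordinate [jb] of [u'] nonzero; as [K] bounds column [jb] of [h], column [ja] is off
   by less than [e]. *)
pose dl : R := if u jb 0 == 0 then e / (K + 1) else 0.
have dl0 : 0 <= dl <= e / (K + 1).
  by rewrite /dl; case: ifP => _; rewrite ?lexx ?divr_ge0 // ltW.
pose u' := u + dl *: delta_mx jb 0.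
have u'b : u' jb 0 != 0.
  have addE (x : 'cV[R]_m.+1) c b : (x + c *: delta_mx b 0) b 0 = x b 0 + c.
    by rewrite !mxE !eqxx mulr1.
  rewrite /u' addE /dl; have [->|ub] := eqVneq (u jb 0) 0; last by rewrite addr0.
  by rewrite add0r gt_eqF // divr_gt0.
pose s := u' ja 0 / u' jb 0; pose w := u' - u' ja 0 *: delta_mx ja 0.
have wE (x : 'cV[R]_m.+1) c b b' :
    (x - c *: delta_mx b 0) b' 0 = x b' 0 - c * (b' == b)%:R.
  by rewrite !mxE andbT.
have wa : w ja 0 = 0 by rewrite wE eqxx mulr1 subrr.
have wb : w jb 0 = u' jb 0 by rewrite wE eq_sym (negbTE ab) mulr0 subr0.
have sb : (s *: delta_mx ja 0 : 'cV[R]_m.+1) jb 0 = 0.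
  by rewrite !mxE eq_sym (negbTE ab) mulr0.
have row0 (x : 'cV[R]_m.+1) c : delta_mx 0 c *m x = (x c 0)%:M.
  by rewrite -rowE; apply/matrixP => i j; rewrite !ord1 !mxE eqxx.
exists (h *m shear (s *: delta_mx ja 0) jb *m shear w ja).
  by rewrite -!congr_mxM; do 2!apply: good_limit_column => //.
split.
  by rewrite !unitmx_mul uh /= !unitmx_transvection //= row0 ?wa ?sb raddf0.
pose C := col ja h.
(* The first shear contributes [s * w_jb = u'_ja] times column [ja], exactly the term removed from
   [u'] to form [w]. *)
have key : (h + s *: (C *m delta_mx 0 jb)) *m w = h *m u'.
  rewrite mulmxDl -scalemxAl -mulmxA row0 wb mul_mx_scalar scalerA divfK //.
  by rewrite /w mulmxBr -scalemxAr -colE subrK.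
have hE : h *m shear (s *: delta_mx ja 0) jb *m shear w ja =
    h + s *: (C *m delta_mx 0 jb) + h *m u' *m delta_mx 0 ja.
  have -> : h *m shear (s *: delta_mx ja 0) jb = h + s *: (C *m delta_mx 0 jb).
    by rewrite /shear mulmxDr mulmx1 mulmxA -scalemxAr -colE -scalemxAl.
  by rewrite /shear mulmxDr mulmx1 mulmxA key.
have hu' : h *m u' = col ja X - C + dl *: col jb h.
  by rewrite /u' mulmxDr /u mulKVmx // -scalemxAr -colE.
have outerE (x : 'cV[R]_m.+1) c i j : (x *m delta_mx 0 c) i j = x i 0 * (j == c)%:R.
  by rewrite mxE big_ord1 mxE eqxx.
have entry i j : (h + s *: (C *m delta_mx 0 jb) + h *m u' *m delta_mx 0 ja) i j =
    h i j + s * (C i 0 * (j == jb)%:R) + (X i ja - C i 0 + dl * h i jb) * (j == ja)%:R.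
  have cE c (Y : 'M[R]_m.+1) : col c Y i 0 = Y i c by rewrite mxE.
  by rewrite !addmxE !scalemxE !outerE hu' !addmxE oppmxE scalemxE !cE.
move=> i j; rewrite ltnS leq_eqVlt hE entry => /orP[/eqP ja'|ja'].
  have -> : j = ja by apply: val_inj.
  rewrite eqxx (negbTE ab) [C i 0]mxE.
  have -> : h i ja + s * (h i ja * false%:R) +
      (X i ja - h i ja + dl * h i jb) * true%:R - X i ja = dl * h i jb.
    by rewrite mulr0 mulr1; ring.
  case/andP: dl0 => dl0 dl1; rewrite normrM ger0_norm //.
  apply: (@le_lt_trans _ _ (e / (K + 1) * K)); last first.
    by rewrite mulrAC ltr_pdivrMr // ltr_pM2l // ltrDl.
  by apply: ler_pM => //; rewrite /K (bigD1 i) //= lerDl sumr_ge0.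
have -> : j == ja = false by apply: ltn_eqF.
have -> : j == jb = false by rewrite -val_eqE /= ltn_eqF // (ltn_trans ja').
by rewrite !mulr0 !addr0; exact: hX.
Qed.

(** * Prescribed Gram matrices *)

Lemma close_congr_left (R : realType) m k (T : 'M[R]_m) (X : 'M[R]_(m, k)) (e : R) :
  0 < e -> exists2 d, 0 < d & forall X', close d X' X -> close e (congr_mx X' T) (congr_mx X T).
Proof.
move=> e0.
have [bnd bndP] : exists K : R, 0 <= K /\ forall (E : 'M[R]_(m, k)) d,
    0 <= d -> d <= 1 -> (forall i j, `|E i j| <= d) ->
    forall i j, `|(E^T *m (T *m X) + X^T *m T *m E + E^T *m T *m E) i j| <= d * K.
  pose K1 : R := \sum_l \sum_j `|(T *m X) l j|.
  pose K2 : R := \sum_l \sum_j `|(X^T *m T) j l|.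
  pose K3 : R := \sum_l \sum_j `|T l j|.
  have mem (I J : finType) (F : I -> J -> R) j : \sum_l `|F l j| <= \sum_l \sum_j `|F l j|.
    by apply: ler_sum => l _; rewrite (bigD1 j) //= lerDl sumr_ge0.
  have nn (I J : finType) (F : I -> J -> R) : 0 <= \sum_l \sum_j `|F l j|.
    by apply: sumr_ge0 => l _; apply: sumr_ge0.
  exists (K1 + K2 + K3); split; first by rewrite !addr_ge0 ?nn.
  move=> E d d0 d1 Ed i j; rewrite !mulrDr.
  rewrite !addmxE.
  apply: le_trans (ler_normD _ _) _; apply: lerD.
    apply: le_trans (ler_normD _ _) _; apply: lerD.
      rewrite mxE; apply: le_trans (ler_norm_sum _ _ _) _.
      apply: le_trans (ler_wpM2l d0 (mem _ _ (T *m X) j)).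
      rewrite mulr_sumr; apply: ler_sum => l _; rewrite normrM mxE.
      by rewrite ler_wpM2r.
    rewrite mxE; apply: le_trans (ler_norm_sum _ _ _) _.
    apply: le_trans (ler_wpM2l d0 (mem _ _ (fun l i => (X^T *m T) i l) i)).
    by rewrite mulr_sumr; apply: ler_sum => l _; rewrite normrM mulrC ler_wpM2r.
  rewrite mxE; apply: le_trans (ler_norm_sum _ _ _) _.
  rewrite /K3 exchange_big mulr_sumr; apply: ler_sum => l _; rewrite normrM.
  rewrite -[leRHS]mulr1; apply: ler_pM => //; last exact: le_trans (Ed _ _) d1.
  rewrite mxE; apply: le_trans (ler_norm_sum _ _ _) _.
  rewrite mulr_sumr; apply: ler_sum => x _; rewrite normrM mxE.
  by rewrite ler_wpM2r.
case: bndP => K0 H.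
have K1 : 0 < bnd + 1 by rewrite ltr_wpDl.
have d0 : 0 < e / (bnd + 1) by rewrite divr_gt0.
exists (Num.min 1 (e / (bnd + 1))); first by rewrite lt_min ltr01.
move=> X' cX i j; set d := Num.min _ _ in cX.
have dle : d <= e / (bnd + 1) by rewrite ge_min lexx orbT.
have -> : congr_mx X' T i j - congr_mx X T i j =
    ((X' - X)^T *m (T *m X) + X^T *m T *m (X' - X) + (X' - X)^T *m T *m (X' - X)) i j.
  have -> : (X' - X)^T = X'^T - X^T by apply/matrixP => a b; rewrite !mxE.
  have -> : congr_mx X' T i j - congr_mx X T i j = (congr_mx X' T - congr_mx X T) i j.
    by rewrite addmxE oppmxE.
  congr (fun_of_matrix _ i j).
  rewrite /congr_mx !mulmxBl !mulmxBr !mulmxA.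
  by apply/matrixP => a b; rewrite !(addmxE, oppmxE); ring.
apply: (@le_lt_trans _ _ (d * bnd)).
  have dge : 0 <= d by rewrite le_min ler01 ltW.
  have d1 : d <= 1 by rewrite ge_min lexx.
  by apply: H => // x y; rewrite addmxE oppmxE ltW // cX.
apply: (@le_lt_trans _ _ (e / (bnd + 1) * bnd)); first by rewrite ler_wpM2r.
by rewrite mulrAC ltr_pdivrMr // ltr_pM2l // ltrDl.
Qed.

(** Pad [X] to a square matrix and bring the first [k] columns of a frame close to it. The last
    column is the auxiliary one of [good_limit_frame], hence [k < m]. *)
Lemma reach_gram (R : realType) m k (T0 T : 'M[R]_m) (X : 'M[R]_(m, k)) (e : R) :
  good T0 T -> (k < m)%N -> 0 < e ->
  exists A : 'M[int]_(m, k), close e (congr_mx (map_mx intr A) T0) (congr_mx X T).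
Proof.
case: m T0 T X => [//|m] T0 T X gT km e0.
have gl : good_limit T0 T by move=> d d0; exists T => //; exact: close_refl.
have e2 : 0 < e / 2 by lra.
have [d d0 Hd] := close_congr_left T X e2.
pose io : 'I_k -> 'I_m.+1 := widen_ord (ltnW km).
pose X' : 'M[R]_m.+1 := \matrix_(i, j) if insub (val j) is Some j' then X i j' else 0.
have [h gh [_ hX]] := good_limit_frame X' gl d0 km.
have subE (M : 'M[R]_m.+1) (S : 'M[R]_m.+1) : congr_mx (colsub io M) S =
    mxsub io io (congr_mx M S).
  apply/matrixP => i j; rewrite !mxE; apply: eq_bigr => l _; rewrite !mxE.
  by congr (_ * _); apply: eq_bigr => l' _; rewrite !mxE.
have rh : reach T0 (congr_mx h T).
  by apply: reach_closed => x x0; have [T1 [r1 _ _] c1] := gh x x0; exists T1.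
have [A HA] := rh _ e2; exists (colsub io A).
have c1 : close (e / 2) (congr_mx (colsub io h) T) (congr_mx X T).
  apply: Hd => i j; rewrite mxE.
  have := hX i (io j) (ltn_ord j); rewrite [X' _ _]mxE.
  case: insubP => [j' _ jE|/negP[]]; last exact: ltn_ord j.
  by rewrite (_ : j' = j) //; apply: val_inj.
apply: (close_trans (e1 := e / 2) _ _ c1); first by rewrite -splitr.
have -> : map_mx intr (colsub io A) = colsub io (map_mx intr A) :> 'M[R]_(_, _).
  by apply/matrixP => i j; rewrite !mxE.
by rewrite !subE => i j; rewrite ![mxsub _ _ _ _ _]mxE; exact: HA.
Qed.

(* If [S i j = a <> 0], subtracting [a^-1 (row i S) /\ (row j S)] kills rows and columns
   [i] and [j]. *)
Lemma skew_split (F : fieldType) n k (S : 'M[F]_k) (A : {set 'I_k}) : skewmx S ->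
  (forall i, S i i = 0) -> (#|A| <= n + n + 1)%N ->
  (forall i j, i \notin A -> S i j = 0) ->
  exists P Q : 'M[F]_(n, k), S = P^T *m Q - Q^T *m P.
Proof.
elim: n S A => [|n IH] S A sS dS cA supp.
  (* At most one index is left in [A], and the diagonal is zero. *)
  exists 0, 0; rewrite trmx0 mul0mx subrr; apply/matrixP => i j; rewrite [RHS]mxE.
  have Sn : S i j = - S j i by have := congr1 (fun M : 'M[F]_k => M j i) sS; rewrite !mxE.
  have [iA|/supp -> //] := boolP (i \in A).
  have [jA|/supp] := boolP (j \in A); last by rewrite Sn => ->; rewrite oppr0.
  have /card_le1_eqP h := cA.
  by rewrite (h _ _ iA jA).
have Sn i j : S i j = - S j i by have := congr1 (fun M : 'M[F]_k => M j i) sS; rewrite !mxE.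
have [S0|] := pselect (forall i j, S i j = 0).
  by exists 0, 0; rewrite trmx0 mul0mx subrr; apply/matrixP => i j; rewrite S0 mxE.
move=> /existsNP[i /existsNP[j /eqP aij]].
pose a := S i j; pose p := row i S; pose q := row j S.
pose S' := S - a^-1 *: wedge p q.
have pE l : p 0 l = S i l by rewrite mxE.
have qE l : q 0 l = S j l by rewrite mxE.
have S'E x y : S' x y = S x y - a^-1 * (S i x * S j y - S j x * S i y).
  by rewrite addmxE oppmxE scalemxE wedgeE !pE !qE.
have ji : j != i by apply: contraNneq aij => ->; rewrite dS.
have iA : i \in A by apply: contraNT aij => /supp ->.
have jA : j \in A by apply: contraNT aij => /supp; rewrite Sn => ->; rewrite oppr0.
have [||||P [Q E]] := IH S' (A :\ i :\ j).
- apply/matrixP => x y; rewrite mxE [RHS]mxE !S'E (Sn x y); ring.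
- by move=> x; rewrite S'E dS; ring.
- move: cA; rewrite (cardsD1 i A) (cardsD1 j (A :\ i)) iA in_setD1 ji jA.
  by move: #|_| => x; lia.
- move=> x y; rewrite !inE !negb_and !negbK S'E => /or3P[/eqP->|/eqP->|xA].
  + by rewrite dS /a; field.
  + by rewrite dS (Sn j i) /a; field.
  + by rewrite (Sn i x) (Sn j x) !(supp _ _ xA); ring.
have H : (col_mx (a^-1 *: p) P)^T *m col_mx q Q -
    (col_mx q Q)^T *m col_mx (a^-1 *: p) P = S.
  rewrite !tr_col_mx !mul_row_col opprD addrACA -E /S' /wedge.
  by rewrite [(a^-1 *: p)^T]linearZ /= -scalemxAl -scalemxAr -scalerBr addrC subrK.
by exists (col_mx (a^-1 *: p) P), (col_mx q Q).
Qed.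

(** * The density theorem *)

Definition mx_form (R : realType) m (M : 'M[R]_m) (u v : 'cV[R]_m) : R :=
  (u^T *m M *m v) 0 0.

Lemma skew_symmetric_mx_form (R : realType) m (M : 'M[R]_m) : skewmx M ->
  exists w : {skew_symmetric 'cV[R]_m}, forall u v, w u v = mx_form M u v.
Proof.
move=> sM.
have al (v : 'cV[R]_m) : zmod_morphism (mx_form M ^~ v).
  by move=> x y; rewrite /mx_form [(x - y)^T]raddfB /= !mulmxBl addmxE oppmxE.
have ar (u : 'cV[R]_m) : zmod_morphism (mx_form M u).
  by move=> x y; rewrite /mx_form mulmxBr addmxE oppmxE.
have sl (v : 'cV[R]_m) : scalable_for *%R (mx_form M ^~ v).
  by move=> c x; rewrite /mx_form [(c *: x)^T]linearZ /= -!scalemxAl scalemxE.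
have sr (u : 'cV[R]_m) : scalable_for (idfun \; *%R) (mx_form M u).
  by move=> c x; rewrite /mx_form -scalemxAr scalemxE.
have he (u v : 'cV[R]_m) : mx_form M u v = (-1) ^+ true * idfun (mx_form M v u).
  rewrite expr1 mulN1r /= /mx_form -[in LHS](trmxK (_ *m v)) mxE.
  by rewrite !trmx_mul trmxK sM mulNmx mulmxN oppmxE mulmxA.
pose bm := isBilinear.Build R 'cV[R]_m 'cV[R]_m R *%R (idfun \; *%R) (mx_form M) al ar sl sr.
pose hm := isHermitianSesquilinear.Build R 'cV[R]_m true idfun (mx_form M) he.
pose w : {skew_symmetric 'cV[R]_m} := HB.pack (mx_form M) bm hm.
by exists w.
Qed.

Lemma mx_form_entry (R : realType) m (M : 'M[R]_m) i j :
  mx_form M (delta_mx i 0) (delta_mx j 0) = M i j.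
Proof. by rewrite /mx_form trmx_delta -rowE -colE !mxE. Qed.

Lemma mx_form_col (R : realType) m k (M : 'M[R]_m) (B : 'M[R]_(m, k)) i j :
  mx_form M (col i B) (col j B) = congr_mx B M i j.
Proof.
rewrite /mx_form /congr_mx !mxE; apply: eq_bigr => l _; rewrite !mxE.
by congr (_ * _); apply: eq_bigr => l' _; rewrite !mxE.
Qed.

Lemma symp_ofE (R : realType) n (g : 'M[R]_(n + n)) u v :
  symp_of g u v = mx_form (congr_mx g (symp_mx R n)) u v.
Proof. by rewrite /symp_of /std_symp /mx_form /congr_mx trmx_mul !mulmxA. Qed.

Lemma symp_mx_skew (R : realType) n : skewmx (symp_mx R n).
Proof.
rewrite /skewmx /symp_mx tr_block_mx opp_block_mx !trmx0 trmx1.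
by rewrite [(- _)^T]linearN /= trmx1 !oppr0 opprK.
Qed.

Lemma symp_mx_unit (R : realType) n : symp_mx R n \in unitmx.
Proof.
have /mulmx1_unit[] // : symp_mx R n *m (- symp_mx R n) = 1%:M.
rewrite mulmxN /symp_mx mulmx_block !mul0mx !mulmx0 !mul1mx !mulmx1 !addr0 !add0r.
by rewrite opp_block_mx !oppr0 opprK -scalar_mx_block.
Qed.

Lemma congr_symp_mx (R : realType) n k (P Q : 'M[R]_(n, k)) :
  congr_mx (col_mx P Q) (symp_mx R n) = P^T *m Q - Q^T *m P.
Proof.
rewrite /congr_mx /symp_mx tr_col_mx mul_row_block !mulmx0 mulmx1 mulmxN mulmx1.
by rewrite mul_row_col addr0 add0r mulNmx addrC.
Qed.

Lemma multiple_of_integral_mx (R : realType) m (b : 'cV[R]_m -> 'cV[R]_m -> R)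
    (T : 'M[R]_m) (c : R) (w : 'M[int]_m) :
  (forall u v, b u v = mx_form T u v) -> skewmx T -> T \in unitmx ->
  T = c *: map_mx intr w -> (0 < m)%N -> multiple_of_integral_symp b.
Proof.
move=> bE sT uT Tw m0; set W : 'M[R]_m := map_mx intr w in Tw.
have c0 : c != 0.
  apply/eqP => c0; have := mulmxV uT; rewrite Tw c0 scale0r mul0mx.
  move=> /matrixP/(_ (Ordinal m0) (Ordinal m0))/eqP.
  by rewrite !mxE eqxx eq_sym oner_eq0.
have WT : W = c^-1 *: T by rewrite Tw scalerA mulVf ?scale1r.
have sW : skewmx W by rewrite /skewmx WT linearZ /= sT scalerN.
have uW : W \in unitmx by rewrite WT unitmxZ ?unitfE ?invr_eq0.
have [f fE] := skew_symmetric_mx_form sW.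
exists c, f; split.
- split=> //; last by rewrite pchar_num.
  apply/eqP/vspaceP => u; rewrite memv0; apply/idP/eqP => [/mem_orthovP H|->]; last first.
    by rewrite mem0v.
  have uW0 : u^T *m W = 0.
    apply/rowP => j; rewrite [RHS]mxE.
    by have := H (delta_mx j 0) (memvf _); rewrite fE /mx_form -colE mxE.
  by apply: trmx_inj; rewrite -[u^T](mulmxK uW) uW0 mul0mx trmx0.
- by move=> i j; rewrite fE mx_form_entry mxE intr_int.
- by move=> u v; rewrite bE fE /mx_form Tw -scalemxAr -scalemxAl scalemxE.
Qed.

Lemma integral_form_int_vec (R : realType) m (w : {skew_symmetric 'cV[R]_m})
    (x y : 'cV[int]_m) :
  integral_form w -> w (int_vec R x) (int_vec R y) \is a Num.int.
Proof.
move=> iw.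
have E (z : 'cV[int]_m) : int_vec R z = \sum_i (z i 0)%:~R *: delta_mx i 0.
  apply/colP => j; rewrite summxE (bigD1 j) //= !mxE !eqxx mulr1.
  by rewrite big1 ?addr0 // => i /negbTE ij; rewrite !mxE eq_sym ij mulr0.
rewrite !E linear_sumlz; apply: rpred_sum => i _.
rewrite linear_sumr; apply: rpred_sum => j _.
by rewrite linearZl_LR linearZr_LR /= !rpredM // ?intr_int.
Qed.

(** Every value is an integer multiple of [c]. In the first coordinate, the open ball of radius
    [|c| / 2] about [c / 2] contains no such multiple; for [c = 0], radius and centre 1 serve. *)
Lemma multiple_not_dense (R : realType) m k (b : 'cV[R]_m -> 'cV[R]_m -> R) : (1 < k)%N ->
  multiple_of_integral_symp b -> ~ dense (integral_values k b).
Proof.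
move=> k1 [c [w [_ iw bE]]] D.
have N0 : (0 < (k * k.-1)./2)%N.
  by case: k k1 {D} => [|[|k]] // _; rewrite half_gt0 /=; lia.
pose a0 := Ordinal N0.
pose p : R := if c == 0 then 1 else c / 2.
pose rr : R := if c == 0 then 1 else `|c| / 2.
have r0 : 0 < rr by rewrite /rr; case: ifPn => // c0; rewrite divr_gt0 ?normr_gt0.
pose P : 'rV[R]_((k * k.-1)./2) := const_mx p.
have [||v [Ov [x _ xE]]] := D (ball P rr)°.
- by exists P; apply: nbhsx_ballx.
- exact: open_interior.
have {Ov} [_ /(_ 0 a0)] := interior_subset Ov.
rewrite -xE !mxE /= bE; set q := w _ _.
have /intrP[z ->] : q \is a Num.int by apply: integral_form_int_vec.
rewrite /ball /= /p /rr; case: eqVneq => [->|c0].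
  by rewrite mul0r subr0 normr1 ltxx.
have -> : c / 2 - c * z%:~R = c * (2^-1 - z%:~R) by ring.
rewrite normrM ltr_pM2l ?normr_gt0 // ltr_norml => /andP[h1 h2].
have z0 : (0 : R) < z%:~R by lra.
have z1 : z%:~R < (1 : R) by lra.
by move: z0 z1; rewrite ltr0z ltrz1; lia.
Qed.

Lemma gram_dense (R : realType) n k (g : 'M[R]_(n + n)) (S : 'M[R]_k) (e : R) :
  (0 < n)%N -> (k < n + n)%N -> \det g = 1 ->
  ~ multiple_of_integral_symp (symp_of g) -> skewmx S -> 0 < e ->
  exists A : 'M[int]_(n + n, k),
    close e (congr_mx (map_mx intr A) (congr_mx g (symp_mx R n))) S.
Proof.
move=> n0 kn g1 nm sS e0.
set Om := congr_mx g (symp_mx R n).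
have gu : g \in unitmx by rewrite unitmxE g1 unitr1.
have sO : skewmx Om by apply: congr_skew; exact: symp_mx_skew.
have uO : Om \in unitmx by rewrite !unitmx_mul unitmx_tr gu symp_mx_unit.
have [I [al [M ex]]] := expansion_exists sO.
have d1 : (1 < \dim (hull M))%N.
  rewrite ltnNge; apply/negP => /(expansion_dim1 ex)[c [w wE]]; apply: nm.
  by apply: multiple_of_integral_mx wE _ => //; [exact: symp_ofE | rewrite addn_gt0 n0].
have [J [be [N [T' [[rT [h hu T'E]] ex' full]]]]] :=
  expansion_saturate ex uO d1 (leq_addl _ _).
have gT' : good Om T'.
  split=> //; first by rewrite T'E; exact: congr_skew.
  exact: expansion_rowfree ex' full.
have dS i : S i i = 0.
  by have := congr1 (fun Q : 'M[R]_k => Q i i) sS; rewrite !mxE; lra.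
have [||P [Q SE]] := @skew_split _ n _ S [set: 'I_k] sS dS.
- by rewrite cardsT card_ord; lia.
- by move=> i j; rewrite inE.
(* [S] is the Gram matrix of [col_mx P Q] for the standard form, and [T'] is the congruence of that
   form by [g *m h]. *)
pose X := invmx (g *m h) *m col_mx P Q.
have XE : congr_mx X T' = S.
  rewrite T'E congr_mxM /Om congr_mxM (mulmxA g) SE -congr_symp_mx mulKVmx //.
  by rewrite unitmx_mul gu.
by have := reach_gram X gT' kn e0; rewrite XE.
Qed.

Lemma lt_pairs_uniq k : uniq (lt_pairs_tuple k).
Proof. by rewrite /= filter_uniq ?enum_uniq. Qed.

Lemma lt_pairs_lt k (a : 'I_((k * k.-1)./2)) :
  ((tnth (lt_pairs_tuple k) a).1 < (tnth (lt_pairs_tuple k) a).2)%N.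
Proof. by have := mem_tnth a (lt_pairs_tuple k); rewrite mem_filter => /andP[]. Qed.

Lemma not_multiple_dense (R : realType) n k (g : 'M[R]_(n + n)) :
  (0 < n)%N -> (k < n + n)%N -> \det g = 1 ->
  ~ multiple_of_integral_symp (symp_of g) -> dense (integral_values k (symp_of g)).
Proof.
move=> n0 kn g1 nm O [x Ox] oO.
have /nbhs_ballP[e /= e0 xO] : nbhs x O by apply: open_nbhs_nbhs.
pose t := lt_pairs_tuple k.
(* The skew matrix whose entries above the diagonal are the coordinates of [x]. *)
pose S : 'M[R]_k := \sum_a x 0 a *:
  (delta_mx (tnth t a).1 (tnth t a).2 - delta_mx (tnth t a).2 (tnth t a).1).
have sS : skewmx S.
  rewrite /skewmx /S linear_sum /= -sumrN; apply: eq_bigr => a _.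
  by rewrite linearZ /= linearB /= !trmx_delta -scalerN opprB.
have SE a : S (tnth t a).1 (tnth t a).2 = x 0 a.
  rewrite /S summxE (bigD1 a) //= big1 ?addr0 => [|b ba].
    rewrite !mxE !eqxx /=; have := lt_pairs_lt a; rewrite -/t.
    by case: eqVneq => [->|_ _]; rewrite ?ltnn // subr0 mulr1.
  rewrite !mxE; have tab : tnth t a != tnth t b.
    by apply: contraNneq ba => /(tuple_uniqP _ (lt_pairs_uniq k)) ->.
  have := lt_pairs_lt a; have := lt_pairs_lt b; rewrite -/t.
  move: tab; case: (tnth t a) (tnth t b) => [a1 a2] [b1 b2] /=; rewrite xpair_eqE.
  move=> /negbTE -> b12 a12; case: andP => [[/eqP Ea /eqP Eb]|_]; last first.
    by rewrite subrr mulr0.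
  by move: a12 b12; rewrite Ea Eb => /ltnW; rewrite leqNgt => /negbTE ->.
have [A HA] := gram_dense n0 kn g1 nm sS e0.
exists (pair_values (symp_of g) (fun i => int_vec R (col i A))); split; last first.
  by exists (fun i => col i A).
apply: xO; split=> // i a; rewrite ord1 mxE -SE /=.
have cE j : int_vec R (col j A) = col j (map_mx intr A) by apply/colP => l; rewrite !mxE.
by rewrite !cE symp_ofE mx_form_col /ball /= distrC; exact: HA.
Qed.

Theorem theorem1p1 (R : realType) (n k : nat) (hn : (2 <= n)%N)
    (hk3 : (3 <= n)%N -> (2 <= k <= n + 2)%N)
    (hk2 : n = 2%N -> k = 2%N \/ k = 3%N)
    (g : 'M[R]_(n + n)) (hg : \det g = 1) :
  dense (integral_values k (symp_of g)) <->
  ~ multiple_of_integral_symp (symp_of g).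
Proof.
(* Both ranges give [1 < k < 2n]: [n + 2 < 2n] for [n >= 3], and [k <= 3 < 4] for [n = 2]. *)
have /andP[k2 kn] : (1 < k < n + n)%N.
  have [n2|n3] := leqP n 2; last by have /andP[] := hk3 n3; lia.
  have nE : n = 2%N by lia.
  by case: (hk2 nE) => ->; rewrite nE.
split; first by move=> D M; exact: multiple_not_dense M D.
by apply: not_multiple_dense => //; lia.
Qed.
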